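(* There exist an MDP model $\{\mathbf X,\mathbf A,p\}$, with $\mathbf X$ countable and endowed with the discrete topology and with an isolated absorbing state $0\in\mathbf X$, and an initial distribution $\mathsf P_0$ on $\mathbf X$, such that all of the following assertions hold: (a) The MDP model is semi-continuous. Consequently, the space $\mathcal P$ of all strategic measures for the initial distribution $\mathsf P_0$ is compact in the weak topology. (b) The MDP model is absorbing (at $0$) for $\mathsf P_0$. (c) The MDP model is not uniformly absorbing (at $0$) for $\mathsf P_0$. (d) The space $\mathcal D$ of occupation measures for $\mathsf P_0$ is not compact with respect to the weak topology. (e) The projection mapping $O:\mathcal P\to\mathcal D$, $O(\mathsf P^\pi_{\mathsf P_0}):=\eta^\pi_{\mathsf P_0}$, is not continuous, where $\mathcal P$ and $\mathcal D$ are both endowed with their weak topologies. (f) The MDP model does not possess a uniform Lyapunov function.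
   Context: MDP model. A topological Borel space is a Borel subset of a completely metrizable separable space. An MDP model $\{\mathbf X,\mathbf A,p\}$ consists of nonempty topological Borel spaces $\mathbf X$ (states) and $\mathbf A$ (actions), with Borel $\sigma$-algebras $\mathcal B(\mathbf X)$, $\mathcal B(\mathbf A)$, and a (measurable) stochastic kernel $p(dy|x,a)$ on $\mathcal B(\mathbf X)$ given $\mathbf X\times\mathbf A$. For discrete spaces write $p(y|x,a)$ for $p(\{y\}|x,a)$. Strategies and strategic measures. Let $\mathbf H:=\mathbf X\times(\mathbf A\times\mathbf X)^\infty$ with the product topology and $\sigma$-algebra (which is its Borel $\sigma$-algebra), with elements $\omega=(x_0,a_1,x_1,a_2,\dots)$, and coordinate maps $X_t(\omega)=x_t$, $A_{t+1}(\omega)=a_{t+1}$, $t\ge0$. A strategy $\pi=\{\pi_t\}_{t\ge1}$ is a sequence of stochastic kernels $\pi_t(da|x_0,a_1,x_1,\dots,a_{t-1},x_{t-1})$ on $\mathcal B(\mathbf A)$ given $(\mathbf X\times\mathbf A)^{t-1}\times\mathbf X$; $\Delta^{\rm All}$ is the set of all strategies. A deterministic stationary strategy is one given by a measurable map $\varphi:\mathbf X\to\mathbf A$ with $\pi_t(da|x_0,\dots,x_{t-1})=\delta_{\varphi(x_{t-1})}(da)$ for all $t$; it is denoted by $\varphi$. Given an initial distribution (probability measure) $\mathsf P_0$ on $\mathbf X$ and $\pi\in\Delta^{\rm All}$, the strategic measure $\mathsf P^\pi_{\mathsf P_0}$ is the unique probability measure on $\mathbf H$ under which $X_0\sim\mathsf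 P_0$, $A_{t+1}$ given $(X_0,A_1,\dots,X_t)$ has law $\pi_{t+1}(da|X_0,A_1,\dots,X_t)$, and $X_{t+1}$ given $(X_0,A_1,\dots,X_t,A_{t+1})$ has law $p(dx|X_t,A_{t+1})$, for all $t\ge0$. Its expectation is $\mathsf E^\pi_{\mathsf P_0}$; write $\mathsf P^\pi_x,\mathsf E^\pi_x$ if $\mathsf P_0=\delta_x$. Put $\mathcal P:=\{\mathsf P^\pi_{\mathsf P_0}:\pi\in\Delta^{\rm All}\}$, with the weak topology (generated by bounded continuous functions on $\mathbf H$). Semi-continuity. The model is semi-continuous (S) if $\mathbf A$ is compact and for each $x\in\mathbf X$ and each bounded measurable $u$ on $\mathbf X$ the function $a\mapsto\int_{\mathbf X}u(y)p(dy|x,a)$ is continuous on $\mathbf A$. It is semi-continuous (W) if $\mathbf A$ is compact and for each bounded continuous $u$ on $\mathbf X$ the function $(x,a)\mapsto\int_{\mathbf X}u(y)p(dy|x,a)$ is continuous on $\mathbf X\times\mathbf A$. It is semi-continuous if it is semi-continuous (S) or semi-continuous (W). Absorbing models. The model is absorbing (at $0$) for $\mathsf P_0$ if there is an isolated point $0\in\mathbf X$ with $p(\{0\}|0,a)=1$ for all $a\in\mathbf A$, and $\mathsf E^\pi_{\mathsf P_0}[T_0]<\infty$ for all $\pi\in\Delta^{\rm All}$, where $T_0:=\inf\{t\ge0:X_t=0\}$ ($\inf\emptyset:=\infty$). A model absorbing (at $0$) for $\mathsf P_0$ is uniformly absorbing (at $0$) for $\mathsf P_0$ if $$\lim_{n\to\infty}\sup_{\pi\in\Delta^{\rm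 All}}\mathsf E^\pi_{\mathsf P_0}\Big[\sum_{t=n}^\infty\mathbb I\{t<T_0\}\Big]=0,$$ where $\mathbb I$ denotes the indicator. Occupation measures. For a model with isolated absorbing state $0$, the occupation measure of $\pi$ for $\mathsf P_0$ is the measure on $(\mathbf X\setminus\{0\})\times\mathbf A$ given by $$\eta^\pi_{\mathsf P_0}(\Gamma^{\mathbf X}\times\Gamma^{\mathbf A}):=\sum_{t=1}^\infty\mathsf P^\pi_{\mathsf P_0}(X_{t-1}\in\Gamma^{\mathbf X},A_t\in\Gamma^{\mathbf A}),\quad \Gamma^{\mathbf X}\in\mathcal B(\mathbf X\setminus\{0\}),\ \Gamma^{\mathbf A}\in\mathcal B(\mathbf A).$$ Put $\mathcal D:=\{\eta^\pi_{\mathsf P_0}:\pi\in\Delta^{\rm All}\}$. If the model is absorbing for $\mathsf P_0$, all elements of $\mathcal D$ are finite measures, and $\mathcal D$ carries the weak topology, i.e. the subspace topology from the space of finite measures on $(\mathbf X\setminus\{0\})\times\mathbf A$ with the coarsest topology making $\eta\mapsto\int g\,d\eta$ continuous for every bounded continuous $g$ on $(\mathbf X\setminus\{0\})\times\mathbf A$. Uniform Lyapunov function. For a semi-continuous MDP model with countable or finite (discrete) $\mathbf X$ and isolated absorbing state $0$, a function $\mu:\mathbf X\to[1,\infty)$ is a uniform Lyapunov function if: (i) $1+\sum_{y\in\mathbf X\setminus\{0\}}p(y|x,a)\mu(y)\le\mu(x)$ for all $x\in\mathbf X$, $a\in\mathbf A$; (ii) for each $x\in\mathbf X$ the map $a\mapsto\sum_{y\in\mathbf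 X\setminus\{0\}}p(y|x,a)\mu(y)$ is continuous on $\mathbf A$; (iii) for each $x\in\mathbf X$ and each deterministic stationary strategy $\varphi$, $\lim_{t\to\infty}\mathsf E^\varphi_x[\mu(X_t)\mathbb I\{\tau_0>t\}]=0$, where $\tau_0:=\inf\{t\ge1:X_t=0\}$. *)

(* Defs.v *)
From HB Require Import structures.
From mathcomp Require Import all_boot all_order all_algebra.
From mathcomp Require Import all_classical all_reals all_analysis.
Import Order.TTheory GRing.Theory Num.Theory.
Import numFieldNormedType.Exports.

Set Implicit Arguments.
Unset Strict Implicit.
Unset Printing Implicit Defensive.

Local Open Scope classical_set_scope.
Local Open Scope ring_scope.
Local Open Scope ereal_scope.

HB.instance Definition _ (T U : ptopologicalType) := Pointed.on (T * U)%type.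
HB.instance Definition _ (I : Type) (T : I -> ptopologicalType) :=
  Pointed.copy (prod_topology T) (forall i, T i).

(* On a countable product of separable metrizable spaces, [borel] of the product
   topology is the product of the Borel sigma-algebras. *)
Notation borel T := (g_sigma_algebraType (@open T)).

Lemma continuous_borel_measurable (S T : ptopologicalType) (f : S -> T) :
  continuous f -> measurable_fun [set: borel S] (f : borel S -> borel T).
Proof.
move=> /continuousP cf.
refine (@measurability _ _ (borel S) (borel T) setT f open erefl _).
by move=> _ [B oB <-]; rewrite setTI; apply: sub_sigma_algebra; exact: cf.
Qed.

(* T is homeomorphic to a Borel subset of a complete separable metric space
   (a Hausdorff pseudometric space is metric). *)
Definition topological_borel_space (R : realType) (T : topologicalType) :=
  exists (S : completePseudoMetricType R) (f : T -> S),
    [/\ hausdorff_space S,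
        exists2 D : set S, countable D & dense D,
        injective f,
        (forall U : set T, open U <-> exists2 V : set S, open V & U = f @^-1` V)
      & measurable (range f : set (borel S))].

Section weak_topology_of_measures.
Variables (R : realType) (T : ptopologicalType).

Definition bounded_continuous : Type :=
  {f : T -> R | continuous f /\ bounded_fun f}.

Definition integrals (mu : {measure set (borel T) -> \bar R}) :
    prod_topology (fun _ : bounded_continuous => R) :=
  fun f => (\int[mu]_x (sval f x))%R.

Definition finite_measures : Type := {finite_measure set (borel T) -> \bar R}.

HB.instance Definition _ := gen_eqMixin finite_measures.
HB.instance Definition _ := gen_choiceMixin finite_measures.

Definition weak_finite_measures : Type :=
  initial_topology
    (fun mu : finite_measures =>
       integrals (mu : {finite_measure set (borel T) -> \bar R})).
HB.instance Definition _ := Topological.on weak_finite_measures.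

Definition weak_probabilities : Type :=
  initial_topology (fun P : probability (borel T) R => integrals P).
HB.instance Definition _ := Topological.on weak_probabilities.

End weak_topology_of_measures.

(* T \ {z} with the subspace topology.  Measurable types are inhabited in the
   library, hence the argument [hz]. *)
Section punctured_space.
Variables (T : ptopologicalType) (z : T) (hz : (~` [set z] : set T) !=set0).

Definition punctured_type : Type := (~` [set z] : set T).
HB.instance Definition _ := Topological.on punctured_type.

Let punctured_point : punctured_type :=
  exist _ (projT1 (cid hz)) (mem_set (projT2 (cid hz))).
HB.instance Definition _ := isPointed.Build punctured_type punctured_point.

Definition punctured : ptopologicalType := punctured_type.

End punctured_space.

Record mdp (R : realType) := Mdp {
  state : ptopologicalType ;
  action : ptopologicalType ;
  state_borel_space : topological_borel_space R state ;
  action_borel_space : topological_borel_space R action ;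
  transition : R.-pker (borel (state * action)%type) ~> borel state }.

Section mdp_definitions.
Variables (R : realType) (M : mdp R).
Local Notation X := (state M).
Local Notation A := (action M).
Local Notation p := (transition M).

Definition trajectory : ptopologicalType :=
  (X * prod_topology (fun _ : nat => (A * X)%type))%type.

Definition state_at (t : nat) (w : trajectory) : X :=
  if t is s.+1 then (w.2 s).2 else w.1.

(* [action_at t] is the coordinate A_(t+1), chosen at X_t. *)
Definition action_at (t : nat) (w : trajectory) : A := (w.2 t).1.

(* ((x_0, a_1), ..., (x_(t-1), a_t), x_t) *)
Definition history (t : nat) : ptopologicalType :=
  (prod_topology (fun _ : 'I_t => (X * A)%type) * X)%type.

Definition history_at (t : nat) (w : trajectory) : history t :=
  (fun i : 'I_t => (state_at i w, action_at i w), state_at t w).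

(* [pi t] is the kernel pi_(t+1). *)
Definition strategy : Type :=
  forall t : nat, R.-pker (borel (history t)) ~> borel A.

Section deterministic_stationary.
Variables (phi : borel X -> borel A) (mphi : measurable_fun [set: borel X] phi).

Lemma deterministic_measurable (t : nat) :
  measurable_fun [set: borel (history t)] (fun h => phi h.2).
Proof.
apply: (measurableT_comp mphi).
by apply: continuous_borel_measurable => h; exact: cvg_snd.
Qed.

Definition deterministic_stationary : strategy :=
  fun t => kdirac (@deterministic_measurable t).

End deterministic_stationary.

(* P is the strategic measure of pi for the initial distribution P0: the
   conditional laws are expressed by integrating over the events generated by
   the conditioning variables.  Such a P exists, with unique values on
   measurable sets, by the Ionescu-Tulcea theorem. *)
Definition is_strategic_measure (P0 : probability (borel X) R) (pi : strategy)
    (P : probability (borel trajectory) R) : Prop :=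
  [/\ forall B : set (borel X), measurable B ->
        P [set w | B (state_at 0 w)] = P0 B,
      forall (t : nat) (C : set (borel (history t))) (G : set (borel A)),
        measurable C -> measurable G ->
        P [set w | C (history_at t w) /\ G (action_at t w)] =
        \int[P]_(w in [set w | C (history_at t w)]) pi t (history_at t w) G
    & forall (t : nat) (C : set (borel (history t * A)%type))
          (B : set (borel X)),
        measurable C -> measurable B ->
        P [set w | C (history_at t w, action_at t w) /\ B (state_at t.+1 w)] =
        \int[P]_(w in [set w | C (history_at t w, action_at t w)])
           p (state_at t w, action_at t w) B].

Definition strategic_measures (P0 : probability (borel X) R) :
    set (weak_probabilities R trajectory) :=
  [set P | exists pi, is_strategic_measure P0 pi P].

Definition semicontinuous_S : Prop :=
  compact [set: A] /\
  forall (x : X) (u : borel X -> R),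
    measurable_fun [set: borel X] u -> bounded_fun u ->
    continuous ((fun a => (\int[p (x, a)]_y u y)%R) : A -> R).

Definition semicontinuous_W : Prop :=
  compact [set: A] /\
  forall u : X -> R, continuous u -> bounded_fun u ->
    continuous ((fun xa => (\int[p xa]_y u y)%R) : (X * A)%type -> R).

Definition semicontinuous : Prop := semicontinuous_S \/ semicontinuous_W.

Definition isolated_absorbing_state (z : X) : Prop :=
  isolated [set: X] z /\ forall a : A, p (z, a) [set z] = 1.

(* First time t >= s with X_t = z, and +oo if there is none: s = 0 gives T_0,
   s = 1 gives tau_0. *)
Definition hitting_time (z : X) (s : nat) (w : trajectory) : \bar R :=
  ereal_inf [set t%:R%:E | t in [set t : nat | (s <= t)%N /\ state_at t w = z]].

Definition absorbing (z : X) (P0 : probability (borel X) R) : Prop :=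
  isolated_absorbing_state z /\
  forall (pi : strategy) (P : probability (borel trajectory) R),
    is_strategic_measure P0 pi P -> \int[P]_w hitting_time z 0 w < +oo.

Definition tail_time (z : X) (n : nat) (w : trajectory) : \bar R :=
  \sum_(n <= t <oo) (t%:R%:E < hitting_time z 0 w)%E%:R%:E.

Definition uniformly_absorbing (z : X) (P0 : probability (borel X) R) : Prop :=
  absorbing z P0 /\
  (fun n : nat => ereal_sup
     [set \int[P]_w tail_time z n w | P in
       [set P : probability (borel trajectory) R |
          exists pi, is_strategic_measure P0 pi P]]) @ \oo --> (0 : \bar R).

(* A finite measure on (X \ {0}) x A is determined by its values on the
   measurable rectangles. *)
Definition is_occupation_measure (z : X) (hz : (~` [set z] : set X) !=set0)
    (P : weak_probabilities R trajectory)
    (eta : weak_finite_measures R (punctured hz * A)%type) : Prop :=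
  forall (GX : set (borel (punctured hz))) (GA : set (borel A)),
    measurable GX -> measurable GA ->
    (eta : {finite_measure set (borel (punctured hz * A)%type) -> \bar R})
      (GX `*` GA) =
    \sum_(0 <= t <oo) (P : probability (borel trajectory) R)
      [set w | (@set_val X (~` [set z]) @` GX) (state_at t w) /\
               GA (action_at t w)].

Definition occupation_measures (z : X) (hz : (~` [set z] : set X) !=set0)
    (P0 : probability (borel X) R) :
    set (weak_finite_measures R (punctured hz * A)%type) :=
  [set eta | exists2 P, strategic_measures P0 P & is_occupation_measure P eta].

Definition is_uniform_lyapunov (z : X) (mu : X -> R) : Prop :=
  let drift (x : X) (a : A) : \bar R :=
    \esum_(y in ~` [set z]) (p (x, a) [set y] * (mu y)%:E) in
  [/\ forall x, (1 <= mu x)%R,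
      forall x a, 1 + drift x a <= (mu x)%:E,
      forall x, continuous (drift x)
    & forall (x : X) (phi : borel X -> borel A)
          (mphi : measurable_fun [set: borel X] phi)
          (P : probability (borel trajectory) R),
        is_strategic_measure (dirac (x : borel X))
          (deterministic_stationary mphi) P ->
        (fun t : nat => \int[P]_w
           ((mu (state_at t w) * (t%:R%:E < hitting_time z 1 w)%E%:R)%R%:E))
          @ \oo --> (0 : \bar R)].

End mdp_definitions.

Arguments occupation_measures {R M z} hz P0.

(* Main.v *)
(* The states are the natural numbers.  From x > 0 one may climb, reaching x + 1
   with probability 1/2, or stay, with probability 1 - 2^-x; otherwise the process
   is absorbed at 0.  It starts in 1.  Since 2^x + 2 dominates 1 plus its expected
   value at the next nonzero state, the expected absorption time is at most 4 for
   every strategy.  Climbing to n + 1 and staying there forever succeeds in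
   climbing with probability 2^-n and then lasts 2^(n+1) steps on average: a total
   occupation mass of 2 sits on the state n + 1, after time n.  Hence absorption
   is not uniform, and the corresponding occupation measures have no cluster
   point, because a finite measure gives small mass to the set of states >= N for
   large N.  As the strategic measures form a compact set, O cannot be continuous.
   The drift inequality for the action "stay" forces mu x >= 2^x for a uniform
   Lyapunov function mu, and then its expected value does not vanish along the
   strategy that always climbs.

   A trajectory is almost surely determined by its actions and by the indicators of
   survival, that is, by a sequence over a four-letter alphabet.  An ultrafilter of
   strategic measures therefore converges on cylinders; the limit weights are
   realized by a random sequence defined on [0, 1[, and they satisfy the closed
   equations that characterize strategic measures. *)
Require Import Defs.
From HB Require Import structures.
From mathcomp Require Import all_boot all_order all_algebra.
From mathcomp Require Import all_classical all_reals all_analysis.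
From mathcomp Require Import measurable_realfun ring lra.
Import Order.TTheory GRing.Theory Num.Theory.
Import numFieldNormedType.Exports.

Set Implicit Arguments.
Unset Strict Implicit.
Unset Printing Implicit Defensive.

Local Open Scope classical_set_scope.
Local Open Scope ring_scope.

(** * Random sequences with prescribed cylinder probabilities *)

(* Strings are read from right to left: the head is the latest term. *)
Fixpoint rprefix (T : Type) (d : nat -> T) (t : nat) : seq T :=
  if t is t'.+1 then d t' :: rprefix d t' else [::].

Lemma size_rprefix (T : Type) (d : nat -> T) t : size (rprefix d t) = t.
Proof. by elim: t => //= t ->. Qed.

Lemma eq_rprefix (T : Type) (d d' : nat -> T) t :
  rprefix d t = rprefix d' t <-> forall i, (i < t)%N -> d i = d' i.
Proof.
elim: t => [|t IH]; first by split.
split => /= [[dt dd'] i|dd'].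
  by rewrite ltnS leq_eqVlt => /predU1P[->//|]; exact: IH.1.
by congr (_ :: _); [exact: dd'|apply/IH => i it; apply/dd'/ltnW].
Qed.

Section digits.
Variables (R : realType) (E : finType) (m : seq E -> R).
Hypotheses (m_ge0 : forall s, 0 <= m s) (m_nil : m [::] = 1)
  (m_cons : forall s, m s = \sum_e m (e :: s)).

Let offset (s : seq E) (k : nat) : R := \sum_(e <- take k (enum E)) m (e :: s).

(* The interval [left_end s, left_end s + m s[ is cut into consecutive
   intervals of lengths m (e :: s), and the digits of a point name the successive
   intervals that contain it. *)
Fixpoint left_end (s : seq E) : R :=
  if s is e :: s' then left_end s' + offset s' (index e (enum E)) else 0.

Let cell (s : seq E) : set R := [set` `[left_end s, left_end s + m s[%R].

Let offset0 s : offset s 0 = 0.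
Proof. by rewrite /offset take0 big_nil. Qed.

Let offsetS s e :
  offset s (index e (enum E)).+1 = offset s (index e (enum E)) + m (e :: s).
Proof.
have ie : (index e (enum E) < size (enum E))%N by rewrite index_mem mem_enum.
rewrite /offset (take_nth e ie) nth_index ?mem_enum//.
by rewrite -cats1 big_cat big_seq1.
Qed.

Let offset_le s : {homo offset s : i j / (i <= j)%N >-> i <= j}.
Proof.
move=> i j ij; rewrite /offset -(subnKC ij) takeD big_cat/= lerDl.
by apply: sumr_ge0 => e _; exact: m_ge0.
Qed.

Let offset_size s : offset s (size (enum E)) = m s.
Proof. by rewrite /offset take_size m_cons big_enum. Qed.

Let cell_cons s e u : cell (e :: s) u <->
  left_end s + offset s (index e (enum E)) <= u <
  left_end s + offset s (index e (enum E)).+1.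
Proof. by rewrite /cell/= in_itv/= offsetS addrA. Qed.

Let cell_sub s e : cell (e :: s) `<=` cell s.
Proof.
move=> u /cell_cons/andP[h1 h2]; rewrite /cell/= in_itv/=; apply/andP; split.
  by apply: le_trans h1; rewrite lerDl -(offset0 s) offset_le.
apply: (lt_le_trans h2); rewrite lerD2l -offset_size; apply: offset_le.
by rewrite index_mem mem_enum.
Qed.

Let cell_inj s e e' u : cell (e :: s) u -> cell (e' :: s) u -> e = e'.
Proof.
wlog ee' : e e' / (index e (enum E) <= index e' (enum E))%N.
  move=> H h h'; have [/H|/ltnW/H] := leqP (index e (enum E)) (index e' (enum E)).
    exact.
  by move=> /(_ h' h).
move=> /cell_cons/andP[_ h1] /cell_cons/andP[h2 _].
move: ee'; rewrite leq_eqVlt => /orP[/eqP|lt_ee'].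
  by move=> /(congr1 (nth e (enum E))); rewrite !nth_index ?mem_enum.
have := lt_le_trans (le_lt_trans h2 h1) (lerD (lexx _) (offset_le s lt_ee')).
by rewrite ltxx.
Qed.

Let cell_cover s u : cell s u -> exists e, cell (e :: s) u.
Proof.
rewrite /cell/= in_itv/= => /andP[h1 h2].
(* The extension whose cell contains [u] is the one just before the first partial sum that carries
   beyond [u]. *)
have ex : exists k, u < left_end s + offset s k.
  by exists (size (enum E)); rewrite offset_size.
have [k hk kmin] := ex_minnP ex.
case: k hk kmin => [|k hk kmin]; first by rewrite offset0 addr0 ltNge h1.
have kE : (k < size (enum E))%N.
  by apply: kmin; rewrite offset_size.
have [e0 _] : exists e0 : E, True.
  by case: (enum E) kE => // e0; exists e0.
exists (nth e0 (enum E) k); apply/cell_cons.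
rewrite index_uniq ?enum_uniq// hk andbT leNgt; apply/negP => /kmin.
by rewrite ltnn.
Qed.

(** The cells of the one-letter extensions of [s] partition the cell of [s], so a point of [[0, 1[]
    lies in exactly one cell of each length, and its digits are found by following these cells. A
    string of mass 0 has an empty cell and is never met. *)
Lemma digits_exist : exists g : R -> nat -> E, forall s,
  [set u | cell [::] u /\ rprefix (g u) (size s) = s] = cell s.
Proof.
(* A default letter for [next]; the alphabet is inhabited because the root cell contains 0 and is
   covered by its children. *)
have [e0 _] : exists e0 : E, True.
  have [e] := @cell_cover [::] 0 (ltac:(by rewrite /cell/= in_itv/= m_nil lexx add0r ltr01)).
  by exists e.
pose next u s := if [pick e | `[< cell (e :: s) u >]] is Some e then e else e0.
pose hist u := fix hist t := if t is t'.+1 then next u (hist t') :: hist t' else [::].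
pose g u t := next u (hist u t).
have gE u t : rprefix (g u) t = hist u t by elim: t => //= t ->.
have hist_cell u t : cell [::] u -> cell (hist u t) u.
  move=> u01; elim: t => //= t IH; rewrite /next; case: pickP => [e /asboolP//|].
  by have [e he] := cell_cover IH => /(_ e)/asboolP.
have cell_nil s : cell s `<=` cell [::].
  by elim: s => // e s IH u /cell_sub; exact: IH.
exists g => s; apply/seteqP; split => u /=.
  by move=> [u01 hs]; rewrite -hs gE; exact: hist_cell.
move=> us; split; first exact: cell_nil us.
rewrite gE; elim: s us => //= e s IH us; rewrite {2}(IH (cell_sub us)).
congr (_ :: _); rewrite IH; last exact: cell_sub us.
rewrite /next; case: pickP => [e' /asboolP h|/(_ e)/asboolP//].
exact: cell_inj h us.
Qed.

End digits.

Lemma uniform_prob_itvco (R : realType) (a b : R) : 0 <= a -> a <= b -> b <= 1 ->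
  uniform_prob (@ltr01 R) `[a, b[%classic = (b - a)%:E.
Proof.
move=> a0 ab b1; rewrite /uniform_prob integral_uniform_pdf setIidl; last first.
  move=> x /=; rewrite !in_itv/= => /andP[ax xb].
  by rewrite (le_trans a0 ax) (le_trans (ltW xb) b1).
rewrite (eq_integral (fun=> 1%E)); last first.
  move=> x; rewrite inE/= in_itv/= => /andP[ax xb]; rewrite /uniform_pdf.
  by rewrite (le_trans a0 ax) (le_trans (ltW xb) b1)/= subr0 invr1.
rewrite integral_cst//= mul1e lebesgue_measure_itv/= lte_fin.
by case: ltgtP ab => // -> _; rewrite subrr.
Qed.

(** Under the uniform law on [[0, 1]], the digits begin with [s] exactly on the cell of [s], up to a
    null set, and that cell has length [m s]. This is a concrete form of Kolmogorov's extension
    theorem for a finite alphabet. *)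
Lemma digit_law_exists (R : realType) (E : finType) (m : seq E -> R) :
  (forall s, 0 <= m s) -> m [::] = 1 -> (forall s, m s = \sum_e m (e :: s)) ->
  exists g : measurableTypeR R -> nat -> E, forall s,
    measurable [set u | rprefix (g u) (size s) = s] /\
    uniform_prob (@ltr01 R) [set u | rprefix (g u) (size s) = s] = (m s)%:E.
Proof.
move=> m_ge0 m_nil m_cons; have [g gE] := digits_exist m_ge0 m_nil m_cons.
pose I := `[0:R, 1[%classic.
have I0 : I 0 by rewrite /I/= in_itv/= lexx ltr01.
have gE' s : [set u | I u /\ rprefix (g u) (size s) = s] =
    `[left_end m s, left_end m s + m s[%classic.
  by rewrite -gE/= m_nil add0r.
have mI : measurable I by rewrite /I; apply: measurable_itv.
(* Outside the null set's complement [I], the digits are frozen at those of 0, which makes the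
   prefix events measurable on the whole line. *)
pose g' u := if `[< I u >] then g u else g 0.
have g'E s : [set u | rprefix (g' u) (size s) = s] `&` I =
    `[left_end m s, left_end m s + m s[%classic.
  rewrite -gE'; apply/seteqP; split => u /=.
    by move=> [+ Iu]; rewrite /g' (asboolT Iu).
  by move=> [Iu]; rewrite /g' (asboolT Iu).
have mA s : measurable [set u | rprefix (g' u) (size s) = s].
  rewrite -(setUIDK [set u | rprefix (g' u) (size s) = s] I).
  rewrite g'E; apply: measurableU => //.
  have [hs|hs] := pselect (rprefix (g 0) (size s) = s).
    rewrite (_ : _ `\` _ = ~` I); first by apply: measurableC.
    apply/seteqP; split => u /=; first by case.
    by move=> nIu; split => //; rewrite /g' (asboolF nIu).
  rewrite (_ : _ `\` _ = set0)//; apply/seteqP; split => u //= [+ nIu].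
  by rewrite /g' (asboolF nIu).
exists g' => s; split; first exact: mA.
have PI : uniform_prob (@ltr01 R) (~` I) = 0%E.
  have PI1 : uniform_prob (@ltr01 R) I = 1%E.
    by rewrite /I uniform_prob_itvco// subr0.
  by rewrite probability_setC// [X in (1 - X)%E]PI1 subee.
rewrite -(setUIDK [set u | rprefix (g' u) (size s) = s] I).
rewrite measureU; last first.
- by apply/seteqP; split => u //= [[_ ?] []].
- by apply: measurableD => //; exact: mA.
- by rewrite g'E.
have hI : uniform_prob (@ltr01 R)
    ([set u | rprefix (g' u) (size s) = s] `\` I) = 0%E.
  apply: (subset_measure0 _ _ _ PI).
  - by apply: measurableD => //; exact: mA.
  - by apply: measurableC.
  - by move=> u [].
rewrite [X in (_ + X)%E]hI adde0 g'E.
have subI u : `[left_end m s, left_end m s + m s[%classic u -> I u.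
  by rewrite -g'E => -[].
have [ms0|ms0] := eqVneq (m s) 0.
  by rewrite ms0 addr0 set_itvco0 measure0.
have {}ms0 : 0 < m s by rewrite lt_def ms0 m_ge0.
(* A nonempty cell lies in [I], which keeps both of its endpoints in [[0, 1]], as the length formula
   requires. *)
have := subI (left_end m s); rewrite /I/= !in_itv/= lexx ltrDl ms0.
move=> /(_ isT)/andP[l0 l1]; rewrite uniform_prob_itvco//.
- by rewrite addrC addKr.
- by rewrite lerDl ltW.
rewrite leNgt; apply/negP => h; have := subI 1; rewrite /I/= !in_itv/= (ltW l1) h.
by move=> /(_ isT); rewrite ltxx andbF.
Qed.

(** * Topology of sequences over a discrete alphabet *)

Section sequence_topology.
Variables (E : ptopologicalType).
Hypothesis (discreteE : forall U : set E, open U).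
Local Notation seqs := (prod_topology (fun _ : nat => E)).

Lemma nbhs_prefix (d : seqs) t : nbhs d [set d' | rprefix d' t = rprefix d t].
Proof.
have : nbhs d [set d' : seqs | forall i : 'I_t, d' i = d i].
  apply: (@filter_forall seqs _ (fun i : 'I_t => [set d' : seqs | d' i = d i])
    (nbhs d) (nbhs_filter d)) => i.
  have : nbhs d (proj (i : nat) @^-1` [set d i]).
    apply: open_nbhs_nbhs; split => //.
    by apply: open_comp => // x _; exact: proj_continuous.
  by apply: filterS => d'.
apply: filterS => d' h; apply/eq_rprefix => i it; exact: (h (Ordinal it)).
Qed.

(** Otherwise there are sequences outside [U] that agree with [d] on longer and longer prefixes;
    they converge to [d] coordinatewise, against the openness of [U]. *)
Lemma open_seq_prefix (U : set seqs) (d : seqs) : open U -> U d ->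
  exists t, forall d' : seqs, rprefix d' t = rprefix d t -> U d'.
Proof.
move=> oU Ud; apply: contrapT => /forallNP noT.
have /choice[f fP] : forall t, exists d' : seqs, rprefix d' t = rprefix d t /\ ~ U d'.
  by move=> t; have /existsNP[d' /not_implyP] := noT t; exists d'.
have fd : f @ \oo --> d.
  apply/cvg_sup => i W [V [[B oB <-] Bdi BW]].
  apply: (filterS BW); exists i.+1 => // t /= it.
  by rewrite ((eq_rprefix _ _ _).1 (fP t).1).
have : nbhs d U by apply: open_nbhs_nbhs.
by move=> /fd[t _ /(_ t (leqnn t))]; exact: (fP t).2.
Qed.

(** Uniform continuity on a space that is compact by Tychonoff's theorem, with a prefix length as
    modulus. *)
Lemma seq_continuous_approx (R : realType) (f : seqs -> R) (e : R) :
    compact [set: E] -> continuous f -> 0 < e ->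
  exists t, forall d d' : seqs, rprefix d' t = rprefix d t -> `|f d - f d'| < e.
Proof.
move=> cE cf e0.
have cT : compact [set: seqs].
  rewrite (_ : setT = [set d : seqs | forall i, setT (d i)]); last by apply/seteqP; split.
  exact: (@tychonoff nat (fun=> E) (fun=> setT)).
(* Compactness replaces the prefix lengths found around each point by a single one. *)
have : \forall t \near \oo, forall d : seqs, setT d ->
    (forall d' : seqs, rprefix d' t = rprefix d t -> `|f d - f d'| < e).
  apply: ((compact_near_coveringP _).1 cT) => d _.
  have e20 : 0 < e / 2 by rewrite divr_gt0.
  have /open_seq_prefix : open (f @^-1` ball (f d) (e / 2)).
    by apply: open_comp => [x _|]; [exact: cf|apply: ball_open].
  move=> /(_ d (ballxx _ e20))[t tP].
  exists ([set d' | rprefix d' t = rprefix d t], [set s | (t <= s)%N]) => /=.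
    split; last by exists t.
    exact: nbhs_prefix.
  move=> [d' s] /= [d't ts] d'' d''d'.
  have := tP d' d't; have := tP d''; rewrite /= /ball/=.
  have -> : rprefix d'' t = rprefix d t.
    rewrite -d't; apply/eq_rprefix => i it.
    by apply: (eq_rprefix _ _ _).1 d''d' _ _; exact: leq_trans ts.
  move=> /(_ erefl) h1 h2; rewrite -(subrKA (f d)) (le_lt_trans (ler_normD _ _))//.
  by rewrite [ltRHS]splitr ltrD// distrC.
by move=> [t _ /(_ t (leqnn t))] h; exists t => d d'; exact: h.
Qed.
End sequence_topology.

(** * Countable discrete spaces *)

Section discrete_spaces.

Lemma discrete_measurable (T : ptopologicalType) (U : set (borel T)) :
  (forall V : set T, open V) -> measurable U.
Proof. by move=> dT; apply: sub_sigma_algebra; exact: dT. Qed.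

Lemma discrete_measurable_fun (T : ptopologicalType) d (S : measurableType d)
    (f : borel T -> S) :
  (forall V : set T, open V) -> measurable_fun setT f.
Proof. by move=> dT _ B _; exact: discrete_measurable. Qed.

Lemma discrete_continuous (T U : topologicalType) (f : T -> U) :
  (forall V : set T, open V) -> continuous f.
Proof. by move=> dT; apply/continuousP => B _; exact: dT. Qed.

Lemma discrete_nbhs (T : topologicalType) (x : T) :
  (forall V : set T, open V) -> nbhs x [set x].
Proof. by move=> dT; apply: open_nbhs_nbhs; split => //; exact: dT. Qed.

Lemma nbhs_discrete (T : topologicalType) :
  (forall x : T, nbhs x [set x]) -> forall V : set T, open V.
Proof.
by move=> h V; rewrite openE => x Vx; apply: filterS (h x) => _ ->.
Qed.

Lemma discrete_prod (T U : topologicalType) :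
  (forall V : set T, open V) -> (forall V : set U, open V) ->
  forall V : set (T * U), open V.
Proof.
move=> dT dU; apply: nbhs_discrete => -[x y].
exists ([set x], [set y]); first by split; exact: discrete_nbhs.
by move=> [a b] /= [-> ->].
Qed.

Lemma discrete_finite_product (I : finType) (T : I -> ptopologicalType) :
  (forall i (V : set (T i)), open V) ->
  forall V : set (prod_topology T), open V.
Proof.
move=> dT; apply: nbhs_discrete => x.
have : nbhs x [set y : prod_topology T | forall i, y i = x i].
  apply: (@filter_forall _ _ (fun i => [set y : prod_topology T | y i = x i])
    (nbhs x) (nbhs_filter x)) => i.
  have : nbhs x (proj i @^-1` [set x i]).
    apply: open_nbhs_nbhs; split => //.
    by apply: open_comp => // y _; exact: proj_continuous.
  by apply: filterS => y.
by apply: filterS => y h; apply: functional_extensionality_dep.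
Qed.

(** Measurability in the parameter is automatic on a discrete space. These two-point kernels provide
    both the transitions of the model and the strategies recovered from cylinder masses. *)
Lemma mixture_kernel_exists (R : realType) (T U : ptopologicalType)
    (q : T -> R) (x y : T -> U) : (forall V : set T, open V) ->
  (forall t, 0 <= q t <= 1) ->
  exists k : R.-pker borel T ~> borel U, forall t B,
    k t B = (q t * \1_B (x t) + (1 - q t) * \1_B (y t))%:E.
Proof.
move=> dT q01.
have q0 t : 0 <= q t by have /andP[] := q01 t.
have q1 t : 0 <= 1 - q t by rewrite subr_ge0; have /andP[] := q01 t.
pose K (t : borel T) : {measure set (borel U) -> \bar R} :=
  measure_add (mscale (NngNum (q0 t)) \d_(x t : borel U))
    (mscale (NngNum (q1 t)) \d_(y t : borel U)).
have KE t B : K t B = (q t * \1_B (x t) + (1 - q t) * \1_B (y t))%:E.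
  rewrite /K/= /msum 2!big_ord_recl big_ord0 adde0/= /mscale/= !diracE.
  by rewrite !indicE.
have mK (B : set (borel U)) : measurable B ->
    measurable_fun [set: borel T] ((fun t => K t B) : borel T -> \bar R).
  by move=> _; exact: (@discrete_measurable_fun T _ (\bar R) (K ^~ B)).
pose k0 : R.-ker borel T ~> borel U :=
  HB.pack K (isKernel.Build _ _ _ _ _ K mK).
have k01 t : k0 t setT = 1%E.
  by rewrite [k0 t setT]KE !indicT !mulr1 addrC subrK.
pose k : R.-pker borel T ~> borel U :=
  HB.pack (k0 : borel T -> {measure set (borel U) -> \bar R})
   (isKernel.Build _ _ _ _ _ K mK)
   (Kernel_isProbability.Build _ _ _ _ _ k0 k01).
by exists k => t B; exact: KE.
Qed.

(** An injection into the naturals embeds the space in the real line with distinct points at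
    distance at least 1: unit balls isolate the points, and the image is countable, hence Borel. *)
Lemma discrete_borel_space (R : realType) (T : ptopologicalType) :
  countable [set: T] -> (forall V : set T, open V) -> topological_borel_space R T.
Proof.
move=> /pcard_leTP/unsquash f dT.
exists R, (fun t => (f t)%:R); split.
- exact: Rhausdorff.
- exists (range (@ratr R)); last exact: dense_rat.
  apply: (card_le_trans (card_image_le _ _)); exact: countableP.
- move=> a b /eqP; rewrite eqr_nat => /eqP; apply: inj; rewrite ?inE//.
- move=> U; split => // _.
  exists (\bigcup_(t in U) ball ((f t)%:R : R) 1).
    by apply: bigcup_open => t _; exact: ball_open.
  apply/seteqP; split => t /=.
    by move=> Ut; exists t => //; exact: ballxx.
  move=> [s Us]; rewrite /ball/= => st.
  have [/inj <-//|fst] := eqVneq (f s) (f t); rewrite ?inE//.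
  move: st; rewrite ltNge => /negP[].
  wlog lt_st : s t {Us} fst / (f s < f t)%N.
    by case: ltngtP fst => // h _; [apply=> //|rewrite distrC; apply=> //];
       rewrite ?ltn_eqF// gtn_eqF.
  by rewrite distrC -natrB 1?ltnW// normr_nat ler1n subn_gt0.
- apply: countable_measurable => [r|].
    by rewrite -[X in measurable X]setCK; apply: measurableC; apply: sub_sigma_algebra;
       apply: closed_openC; exact: closed_eq.
  apply: (card_le_trans (card_image_le _ _)); apply/pcard_leTP; exact: squash f.
Qed.

End discrete_spaces.

(** * Conditional laws given countably many values *)

Section countable_laws.
Local Open Scope ereal_scope.
Context d (W : measurableType d) (R : realType) (P : probability W R).

Lemma integral_cst_on (k : W -> \bar R) (c : \bar R) (D : set W) :
  measurable D -> (forall w, D w -> k w = c) -> \int[P]_(w in D) k w = c * P D.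
Proof.
move=> mD kc; rewrite (eq_integral (cst c)) ?integral_cst//.
by move=> w /set_mem; exact: kc.
Qed.

(** By countable additivity over the values of [Y], a conditional law need only be checked on single
    values. *)
Lemma countable_conditional_law (T : Type) (Y : W -> T) (E : set W)
    (k : T -> \bar R) :
  countable [set: T] -> (forall C, measurable (Y @^-1` C)) -> measurable E ->
  (forall y, 0 <= k y) ->
  (forall y, P (Y @^-1` [set y] `&` E) = k y * P (Y @^-1` [set y])) ->
  forall C, P (Y @^-1` C `&` E) = \int[P]_(w in Y @^-1` C) k (Y w).
Proof.
move=> /pcard_leTP/unsquash f mY mE k0 kP C.
have finj y z : f y = f z -> y = z by move=> /inj; apply; rewrite inE.
pose F n := Y @^-1` (C `&` f @^-1` [set n]).
have FE : Y @^-1` C = \bigcup_n F n.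
  apply/seteqP; split => [w Cw|w [n _ []]//].
  by exists (f (Y w)).
have tF : trivIset setT F.
  by move=> i j _ _ [w [[_ /= <-] [_ /= <-]]].
rewrite FE setI_bigcupl measure_semi_bigcup//=; last 3 first.
- by move=> n; apply: measurableI => //; exact: mY.
- by apply: trivIset_setIr.
- by apply: bigcup_measurable => n _; apply: measurableI => //; exact: mY.
rewrite ge0_integral_bigcup//=; last 2 first.
- by move=> n; exact: mY.
- move=> _ B mB; apply: measurableI; first by apply: bigcup_measurable => n _; exact: mY.
  by have -> : (fun w => k (Y w)) @^-1` B = Y @^-1` (k @^-1` B) by []; exact: mY.
apply: eq_eseriesr => n _.
have [[y [Cy fy]]|h] := pselect (exists y, C y /\ f y = n).
  have -> : F n = Y @^-1` [set y].
    apply/seteqP; split => w; first by move=> [_ /= Ywn]; apply: finj; rewrite fy.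
    by move=> /= Yw; split; rewrite /= Yw.
  rewrite kP (@integral_cst_on _ (k y)); [by []|exact: mY|].
  by move=> w; exact: congr1.
have -> : F n = set0 by apply/seteqP; split => // w [CY fY]; apply: h; exists (Y w).
by rewrite set0I measure0 integral_set0.
Qed.

(** Countable additivity again, now over the values of [Z]. *)
Lemma countable_product_law d' (T : measurableType d') (Z : W -> T) (A : set W)
    (nu : {measure set T -> \bar R}) :
  countable [set: T] -> (forall B : set T, measurable B) ->
  measurable A -> measurable_fun setT Z ->
  (forall z, P (A `&` Z @^-1` [set z]) = nu [set z] * P A) ->
  forall B, P (A `&` Z @^-1` B) = nu B * P A.
Proof.
move=> /pcard_leTP/unsquash f mT mA mZ zP B.
have finj y z : f y = f z -> y = z by move=> /inj; apply; rewrite inE.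
pose F n := B `&` f @^-1` [set n].
have FE : B = \bigcup_n F n.
  by apply/seteqP; split => [z Bz|z [n _ []]//]; exists (f z).
have tF : trivIset setT F by move=> i j _ _ [w [[_ /= <-] [_ /= <-]]].
have mZB C : measurable (Z @^-1` C) by rewrite -[X in measurable X]setTI; exact: mZ.
rewrite FE preimage_bigcup setI_bigcupr measure_semi_bigcup//=; last 3 first.
- by move=> n; exact: measurableI.
- by apply: trivIset_setIl => i j _ _ [w [[_ /= <-] [_ /= <-]]].
- by apply: bigcup_measurable => n _; exact: measurableI.
have PA : P A = (fine (P A))%:E by rewrite fineK// fin_num_measure.
rewrite measure_semi_bigcup// muleC PA -nneseriesZl//.
apply: eq_eseriesr => n _; rewrite -PA muleC.
have [[z [Bz fz]]|h] := pselect (exists z, B z /\ f z = n).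
  have -> : F n = [set z].
    apply/seteqP; split => w; first by move=> [_ /= fw]; apply: finj; rewrite fz.
    by move=> /= ->; split.
  exact: zP.
have -> : F n = set0 by apply/seteqP; split => // w [Bw fw]; apply: h; exists w.
by rewrite preimage_set0 setI0 !measure0 mul0e.
Qed.

End countable_laws.

(** * Decision processes with countable discrete states and actions *)

Section discrete_mdp.
Variables (R : realType) (M : mdp R).
Local Notation X := (state M).
Local Notation A := (action M).
Local Notation H := (trajectory M).
Hypotheses (dX : forall U : set X, open U) (dA : forall U : set A, open U).
Hypotheses (cX : countable [set: X]) (cA : countable [set: A]).

Lemma discrete_history t (U : set (history M t)) : open U.
Proof.
apply: discrete_prod => //; apply: discrete_finite_product => _.
exact: discrete_prod.
Qed.

Lemma continuous_proj (n : nat) :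
  continuous ((fun f => f n) : prod_topology (fun _ : nat => (A * X)%type) -> (A * X)%type).
Proof. exact: (@proj_continuous nat (fun=> (A * X)%type) n). Qed.

Lemma continuous_state_at t : continuous (@state_at R M t : H -> X).
Proof.
case: t => [|t]; first by move=> w; exact: cvg_fst.
move=> w; apply: (@continuous_comp _ _ _ (fun w : H => w.2 t) snd); last exact: cvg_snd.
apply: (@continuous_comp _ _ _
  (snd : H -> prod_topology (fun _ : nat => (A * X)%type)) (fun f => f t)).
  exact: cvg_snd.
exact: continuous_proj.
Qed.

Lemma continuous_action_at t : continuous (@action_at R M t : H -> A).
Proof.
move=> w; apply: (@continuous_comp _ _ _ (fun w : H => w.2 t) fst); last exact: cvg_fst.
apply: (@continuous_comp _ _ _
  (snd : H -> prod_topology (fun _ : nat => (A * X)%type)) (fun f => f t)).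
  exact: cvg_snd.
exact: continuous_proj.
Qed.

Lemma measurable_state_at t (U : set X) : measurable (@state_at R M t @^-1` U : set (borel H)).
Proof.
apply: sub_sigma_algebra; apply: open_comp; last exact: dX.
by move=> w _; exact: continuous_state_at.
Qed.

Lemma measurable_action_at t (U : set A) : measurable (@action_at R M t @^-1` U : set (borel H)).
Proof.
apply: sub_sigma_algebra; apply: open_comp; last exact: dA.
by move=> w _; exact: continuous_action_at.
Qed.

(** Invariance under equality of histories up to time [t]; as the spaces are discrete, these are
    exactly the events generated by [history_at t]. *)
Definition nonanticipating t (E : set H) :=
  forall w w', history_at t w = history_at t w' -> E w -> E w'.

Lemma eq_history_at t (w w' : H) : history_at t w = history_at t w' <->
  (forall i, (i <= t)%N -> state_at i w = state_at i w') /\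
  (forall i, (i < t)%N -> action_at i w = action_at i w').
Proof.
split => [[hh ht]|[hs ha]].
  split => i; last first.
    by move=> it; have := congr1 (fun f => (f (Ordinal it)).2) hh.
  rewrite leq_eqVlt => /predU1P[->//|it].
  by have := congr1 (fun f => (f (Ordinal it)).1) hh.
congr pair; last exact: hs.
by apply/funext => i; rewrite hs ?ha// ltnW.
Qed.

Lemma nonanticipatingP t (E : set H) : nonanticipating t E ->
  exists C : set (history M t), E = history_at t @^-1` C.
Proof.
move=> nE; exists (history_at t @` E); apply/seteqP; split => w; first by exists w.
by move=> [w' Ew' /nE]; apply.
Qed.

Lemma countable_injection (T : Type) : countable [set: T] ->
  exists f : T -> nat, injective f.
Proof.
by move=> /countable_injP[f finj]; exists f => x y; apply: finj; rewrite inE.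
Qed.

Lemma countable_history t : countable [set: history M t].
Proof.
have [f finj] := countable_injection cX; have [g ginj] := countable_injection cA.
pose code (h : history M t) : ({ffun 'I_t -> nat * nat} * nat)%type :=
  ([ffun i => (f (h.1 i).1, g (h.1 i).2)], f h.2).
apply/countable_injP; exists (pickle \o code) => -[h x] [h' x'] _ _.
move=> /(pcan_inj pickleK)[/ffunP hh /finj <-]; congr pair.
apply/funext => i; have := hh i; rewrite !ffunE => -[/finj + /ginj].
by case: (h i) (h' i) => [? ?] [? ?]/= -> ->.
Qed.

(** Finitely many discrete coordinates decide the event, so it contains a basic neighbourhood of
    each of its points. *)
Lemma open_nonanticipating t (E : set H) : nonanticipating t E -> open E.
Proof.
move=> nE; rewrite openE => w Ew.
have ns : nbhs w [set w' : H | forall i : 'I_t.+1, state_at i w' = state_at i w].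
  apply: (@filter_forall _ _ (fun i : 'I_t.+1 =>
    [set w' : H | state_at i w' = state_at i w]) (nbhs w) (nbhs_filter w)) => i.
  by apply: (@continuous_state_at i w [set state_at i w]); exact: discrete_nbhs.
have na : nbhs w [set w' : H | forall i : 'I_t, action_at i w' = action_at i w].
  apply: (@filter_forall _ _ (fun i : 'I_t =>
    [set w' : H | action_at i w' = action_at i w]) (nbhs w) (nbhs_filter w)) => i.
  by apply: (@continuous_action_at i w [set action_at i w]); exact: discrete_nbhs.
apply: filterS (filterI ns na) => w' [hs ha]; apply: nE Ew; apply/eq_history_at.
split => i it; apply/esym.
  exact: (hs (Ordinal (it : i < t.+1)%N)).
exact: (ha (Ordinal it)).
Qed.

Lemma measurable_nonanticipating t (E : set H) :
  nonanticipating t E -> measurable (E : set (borel H)).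
Proof. by move=> nE; apply: sub_sigma_algebra; exact: open_nonanticipating nE. Qed.

Lemma measurable_history_at t (C : set (history M t)) :
  measurable (history_at t @^-1` C : set (borel H)).
Proof. by apply: (@measurable_nonanticipating t) => w w' /= ->. Qed.

(** There are only countably many histories, so the integral equations that define a strategic
    measure reduce to identities on atoms. *)
Lemma strategic_measureP (P0 : probability (borel X) R) (pi : strategy M)
    (P : probability (borel H) R) :
  (forall B : set (borel X), P (state_at 0 @^-1` B) = P0 B) ->
  (forall t (h : history M t) a,
     P (history_at t @^-1` [set h] `&` action_at t @^-1` [set a]) =
     (pi t h [set a] * P (history_at t @^-1` [set h]))%E) ->
  (forall t (h : history M t) a y,
     P (history_at t @^-1` [set h] `&` action_at t @^-1` [set a] `&`
        state_at t.+1 @^-1` [set y]) =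
     (transition M (h.2, a) [set y] *
     P (history_at t @^-1` [set h] `&` action_at t @^-1` [set a]))%E) ->
  is_strategic_measure P0 pi P.
Proof.
move=> PB Ppi Pp; split; first by move=> B _; exact: PB.
  move=> t C G _ _.
  apply: (@countable_conditional_law _ _ _ P _ (history_at t) _
    (fun h => pi t h G)) => [|D||//|h].
  - exact: countable_history.
  - exact: measurable_history_at.
  - exact: measurable_action_at.
  apply: (@countable_product_law _ _ _ P _ (borel A) (@action_at R M t)) => //.
  - by move=> B; exact: discrete_measurable.
  - exact: measurable_history_at.
  - by move=> _ B _; rewrite setTI; exact: measurable_action_at.
move=> t C B _ _.
pose Y (w : borel H) := (history_at t w, action_at t w).
apply: (@countable_conditional_law _ _ _ P _ Y _
    (fun ha => transition M (ha.1.2, ha.2) B)) => [|D||//|[h a]].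
- have [f finj] := countable_injection (countable_history t).
  have [g ginj] := countable_injection cA.
  apply/countable_injP; exists (fun z => pickle (f z.1, g z.2)) => -[? ?] [? ?] _ _.
  by move=> /(pcan_inj pickleK)[/finj/= -> /ginj ->].
- by apply: (@measurable_nonanticipating t.+1) => w w'; rewrite /Y/= => /eq_history_at[hs ha];
    rewrite (_ : history_at t w' = history_at t w) ?ha//; apply/esym/eq_history_at;
    split => i it; [apply: hs|apply: ha]; rewrite ltnW.
- exact: measurable_state_at.
have -> : Y @^-1` [set (h, a)] = history_at t @^-1` [set h] `&` action_at t @^-1` [set a].
  by apply/seteqP; split => w; [case|move=> [/= hw aw]; rewrite /Y/= hw aw].
apply: (@countable_product_law _ _ _ P _ (borel X) (@state_at R M t.+1)) => //.
- by move=> B'; exact: discrete_measurable.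
- apply: measurableI; first exact: measurable_history_at.
  exact: measurable_action_at.
- by move=> _ B' _; rewrite setTI; exact: measurable_state_at.
Qed.

Section strategic_measure_theory.
Variables (P0 : probability (borel X) R) (pi : strategy M).
Variables (P : probability (borel H) R) (sP : is_strategic_measure P0 pi P).
Variables (t : nat) (x : X) (E : set H).
Hypotheses (nE : nonanticipating t E) (Ex : E `<=` state_at t @^-1` [set x]).

(** On [E] the current state is [x], so the integrand in the defining equation is constant. *)
Lemma strategic_transition (a : A) (B : set X) :
  P (E `&` action_at t @^-1` [set a] `&` state_at t.+1 @^-1` B) =
  (transition M (x, a) B * P (E `&` action_at t @^-1` [set a]))%E.
Proof.
have [C EC] := nonanticipatingP nE; have [_ _ sP3] := sP.
have Ex' := Ex; rewrite EC in Ex' *.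
have -> : history_at t @^-1` C `&` action_at t @^-1` [set a] `&` state_at t.+1 @^-1` B =
  [set w | [set h : history M t * A | C h.1 /\ h.2 = a]
             (history_at t w, action_at t w) /\ B (state_at t.+1 w)] by [].
rewrite sP3; last exact: discrete_measurable.
  rewrite (@integral_cst_on _ _ _ P _ (transition M (x, a) B))//.
    have mCa : measurable (history_at t @^-1` C `&` action_at t @^-1` [set a] : set (borel H)).
      by apply: measurableI; [exact: measurable_history_at|exact: measurable_action_at].
    exact: mCa.
  by move=> w [/= Cw ->]; congr (transition M (_, _) _); exact: Ex'.
apply: discrete_measurable => V.
exact: (@discrete_prod (history M t) A (@discrete_history t) dA V).
Qed.

Lemma strategic_action (a : A) : (forall h : history M t, h.2 = x -> pi t h [set a] = 1%E) ->
  P (E `&` action_at t @^-1` [set a]) = P E.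
Proof.
have [C EC] := nonanticipatingP nE; have [_ sP2 _] := sP.
have Ex' := Ex; rewrite EC in Ex' *.
move=> pia.
have -> : history_at t @^-1` C `&` action_at t @^-1` [set a] =
  [set w | C (history_at t w) /\ [set a] (action_at t w)] by [].
rewrite sP2; last exact: discrete_measurable.
  rewrite (@integral_cst_on _ _ _ P _ 1%E) ?mul1e//.
    exact: measurable_history_at.
  by move=> w /= Cw; apply: pia; exact: Ex'.
by apply: discrete_measurable => V; exact: discrete_history.
Qed.

End strategic_measure_theory.

Definition path_event (x : nat -> X) (t : nat) : set H :=
  [set w | forall s, (s <= t)%N -> state_at s w = x s].

Lemma nonanticipating_path_event x t : nonanticipating t (path_event x t).
Proof.
by move=> w w' /eq_history_at[hs _] h s st; rewrite -hs//; exact: h.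
Qed.

(** Intersecting with the action prescribed at [x t] loses no mass, and the transition to [x t.+1]
    then multiplies the mass by its probability. *)
Lemma path_event_ge (P0 : probability (borel X) R) (phi : borel X -> borel A)
    (mphi : measurable_fun [set: borel X] phi) (P : probability (borel H) R)
    (x : nat -> X) t :
  is_strategic_measure P0 (deterministic_stationary mphi) P ->
  (transition M (x t, phi (x t)) [set x t.+1] * P (path_event x t) <=
   P (path_event x t.+1))%E.
Proof.
move=> sP; have nE := @nonanticipating_path_event x t.
have Ex : path_event x t `<=` state_at t @^-1` [set x t] by move=> w; apply.
rewrite -(@strategic_action _ _ _ sP _ _ _ nE Ex (phi (x t))); last first.
  by move=> h hx; rewrite /deterministic_stationary/= /kdirac diracE mem_set//= hx.
rewrite -(strategic_transition sP nE Ex); apply: (le_measure P); rewrite ?inE//.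
- apply: measurableI; last exact: measurable_state_at.
  apply: measurableI; last exact: measurable_action_at.
  exact: (measurable_nonanticipating nE).
- apply: measurable_nonanticipating; exact: nonanticipating_path_event.
move=> w [[wx _] xt] s; rewrite leq_eqVlt => /predU1P[->//|]; exact: wx.
Qed.

End discrete_mdp.

(** * Measurability and convergence in spaces of sequences *)

Section sequence_measurability.
Variables (E : ptopologicalType) (T : ptopologicalType).
Hypothesis cE : countable [set: E].
Local Notation seqs := (prod_topology (fun _ : nat => E)).

Lemma countable_bigcup_measurable d (S : measurableType d) (I : Type)
    (D : set I) (F : I -> set S) :
  countable [set: I] -> (forall i, measurable (F i)) ->
  measurable (\bigcup_(i in D) F i).
Proof.
move=> /countable_injection[f finj] mF.
have -> : \bigcup_(i in D) F i = \bigcup_n \bigcup_(i in D `&` f @^-1` [set n]) F i.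
  apply/seteqP; split => x; first by move=> [i Di Fi]; exists (f i) => //; exists i.
  by move=> [n _ [i [Di _] Fi]]; exists i.
apply: bigcupT_measurable => n.
have [[i [Di fi]]|h] := pselect (exists i, D i /\ f i = n).
  rewrite (_ : \bigcup_(_ in _) _ = F i)//; apply/seteqP; split => x.
    by move=> [j [_ /= fj]]; rewrite (finj j i)// fj.
  by move=> Fi; exists i.
rewrite (_ : \bigcup_(_ in _) _ = set0)//; apply/seteqP; split => x//.
by move=> [i [Di fi]] _; apply: h; exists i.
Qed.

(** By [open_seq_prefix], the preimage of an open set is a union of prefix events, and there are
    only countably many strings. *)
Lemma prefix_measurable_comp d (S : measurableType d) (g : S -> seqs) (F : seqs -> T) :
  (forall s, measurable [set u | rprefix (g u) (size s) = s]) -> continuous F ->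
  measurable_fun [set: S] (F \o g : S -> borel T).
Proof.
move=> mg cF.
refine (@measurability _ _ S (borel T) setT _ open erefl _).
move=> _ [B oB <-]; rewrite setTI.
have oFB : open (F @^-1` B) by apply: open_comp => // x _; exact: cF.
have -> : (F \o g) @^-1` B =
    \bigcup_(s in [set s | [set d : seqs | rprefix d (size s) = s] `<=` F @^-1` B])
      [set u | rprefix (g u) (size s) = s].
  apply/seteqP; split => u; last by move=> [s sB /sB].
  move=> /(open_seq_prefix oFB)[t tB].
  exists (rprefix (g u) t); last by rewrite /= size_rprefix.
  by move=> d'; rewrite /= size_rprefix; exact: tB.
have [f finj] := countable_injection cE.
apply: countable_bigcup_measurable => //.
apply/countable_injP; exists (fun s => pickle (map f s)) => s s' _ _.
by move=> /(pcan_inj pickleK)/(inj_map finj).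
Qed.

Lemma cvg_product (I : Type) (K : I -> topologicalType) (S : Type)
    (F : set_system S) (f : S -> prod_topology K) (l : prod_topology K) :
  Filter F -> (forall i, (fun x => f x i) @ F --> l i) -> f @ F --> l.
Proof.
move=> FF fl; apply/cvg_sup => i W [V [[B oB <-] Bli BW]].
by apply: (filterS BW); apply: (fl i); exact: open_nbhs_nbhs.
Qed.

Lemma cvg_initial (S : choiceType) (U : topologicalType) (f : S -> U)
    (I : Type) (F : set_system I) (g : I -> initial_topology f) (l : initial_topology f) :
  Filter F -> (f \o g) @ F --> f l -> g @ F --> l.
Proof.
move=> FF fgl W [V [[B oB <-] Bli BW]].
by apply: (filterS BW); apply: fgl; exact: open_nbhs_nbhs.
Qed.

(** The image of the ultrafilter clusters in [K], and an ultrafilter converges to each of its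
    cluster points. *)
Lemma ultra_cvg_compact (S : Type) (U : topologicalType) (F : set_system S)
    (f : S -> U) (K : set U) :
  UltraFilter F -> compact K -> F (f @^-1` K) -> exists2 l, K l & f @ F --> l.
Proof.
move=> FU cK FK; have [l [Kl lF]] := cK (f @ F) _ FK; exists l => // V Vl.
have [//|FV] := in_ultra_setVsetC (f @^-1` V) FU.
by have [x []] := lF (~` V) V FV Vl.
Qed.

End sequence_measurability.

(** * The model *)

Section model.
Variable R : realType.

(* Action true climbs, action false stays.  The detour through .-1.+1 only
   matters at the absorbing state 0: it makes the target of a survival nonzero. *)
Definition target (x : nat) (a : bool) : nat := (if a then x else x.-1).+1.

Definition survival (x : nat) (a : bool) : R :=
  if x == 0%N then 0 else if a then 2^-1 else 1 - 2^-1 ^+ x.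

Lemma survival01 x a : 0 <= survival x a <= 1.
Proof.
rewrite /survival; case: eqP => _; first by rewrite lexx ler01.
case: a; first by apply/andP; split; lra.
have h0 : 0 <= (2^-1 : R) ^+ x by apply: exprn_ge0; lra.
have h1 : (2^-1 : R) ^+ x <= 1 by apply: exprn_ile1; lra.
by rewrite subr_ge0 h1 gerDl oppr_le0.
Qed.

Lemma discrete_nat_bool (U : set (nat * bool)) : open U.
Proof. by apply: discrete_prod => V; exact: discrete_open. Qed.

Lemma discrete_bool_bool (U : set (bool * bool)) : open U.
Proof. by apply: discrete_prod => V; exact: discrete_open. Qed.

Lemma model_kernel_exists : exists p : R.-pker borel (nat * bool)%type ~> borel nat,
  forall xa B, p xa B = (survival xa.1 xa.2 * \1_B (target xa.1 xa.2) +
                         (1 - survival xa.1 xa.2) * \1_B 0%N)%:E.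
Proof.
apply: (@mixture_kernel_exists R (nat * bool)%type nat
   (fun xa => survival xa.1 xa.2) (fun xa => target xa.1 xa.2) (fun=> 0%N)).
  exact: discrete_nat_bool.
by move=> xa; exact: survival01.
Qed.

Lemma nat_borel_space : topological_borel_space R nat.
Proof. by apply: discrete_borel_space => [|U]; [exact: countableP|exact: discrete_open]. Qed.

Lemma bool_borel_space : topological_borel_space R bool.
Proof. by apply: discrete_borel_space => [|U]; [exact: countableP|exact: discrete_open]. Qed.

Definition model : mdp R :=
  Mdp nat_borel_space bool_borel_space (projT1 (cid model_kernel_exists)).

Lemma transitionE (x : nat) (a : bool) (B : set nat) :
  transition model (x, a) B =
  (survival x a * \1_B (target x a) + (1 - survival x a) * \1_B 0%N)%:E.
Proof. exact: (projT2 (cid model_kernel_exists)). Qed.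

Local Notation H := (trajectory model).
Local Notation digits := (prod_topology (fun _ : nat => (bool * bool)%type)).


(* A digit (a, c) records an action and whether the next state is nonzero; a
   string of digits is read from right to left, starting in state 1. *)
Fixpoint string_state (s : seq (bool * bool)) : nat :=
  if s is (a, c) :: s' then if c then target (string_state s') a else 0%N else 1%N.

Definition decode (d : digits) : H :=
  (1%N, fun t => ((d t).1, string_state (rprefix d t.+1))).

Definition encode (w : H) : digits :=
  fun t => (action_at t w, state_at t.+1 w != 0%N).

Lemma state_at_decode d t : state_at t (decode d) = string_state (rprefix d t).
Proof. by case: t. Qed.

Lemma action_at_decode d t : action_at t (decode d) = (d t).1.
Proof. by []. Qed.

(** The survival digit can be read off the next state because a target is never 0. *)
Lemma encodeK d : encode (decode d) = d.
Proof.
by apply/funext => t; rewrite /encode action_at_decode state_at_decode/=; case: (d t) => a [].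
Qed.

(** These trajectories are exactly the values of [decode], and they carry every strategic measure
    that starts in 1. *)
Definition legal (w : H) : Prop := state_at 0 w = 1%N /\ forall t,
  state_at t.+1 w = 0%N \/ state_at t.+1 w = target (state_at t w) (action_at t w).

(** On a legal trajectory the next state is determined by the current state, the action and whether
    the next state is 0. *)
Lemma decodeK w : legal w -> decode (encode w) = w.
Proof.
move=> [w0 wS].
have st t : string_state (rprefix (encode w) t) = state_at t w.
  elim: t => [|t IH]; first by rewrite w0.
  have -> : string_state (rprefix (encode w) t.+1) =
      if state_at t.+1 w != 0%N then target (string_state (rprefix (encode w) t))
        (action_at t w) else 0%N by [].
  by rewrite IH; case: (wS t) => ->.
case: w w0 wS st => x f /= w0 wS st; congr pair; first by rewrite w0.
apply/funext => t; have := st t.+1 => /= ->.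
by rewrite /action_at/=; case: (f t).
Qed.

(** Each coordinate of the trajectory depends on a finite prefix of the digits, hence is locally
    constant. *)
Lemma continuous_decode : continuous decode.
Proof.
move=> d.
pose G d' : prod_topology (fun _ : nat => (bool * nat)%type) := (decode d').2.
have cG : G @ nbhs d --> G d.
  apply: cvg_product => t; apply: cvg_near_cst.
  apply: filterS (nbhs_prefix (discrete_bool_bool) d t.+1) => d' dd'.
  by case: dd' => dt dd; rewrite /G /decode/= dt dd.
exact: (cvg_pair (cvg_cst (1%N : nat)) cG).
Qed.

Lemma eq_history_decode t (d d' : digits) :
  history_at t (decode d) = history_at t (decode d') <-> rprefix d t = rprefix d' t.
Proof.
split => [/eq_history_at[hs ha]|dd'].
  apply/eq_rprefix => i it.
  by rewrite -(encodeK d) -(encodeK d') /encode (ha _ it) (hs _ it).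
have ddi := (eq_rprefix _ _ _).1 dd'.
apply/eq_history_at; split => i it; last by rewrite !action_at_decode ddi.
rewrite !state_at_decode; congr string_state; apply/eq_rprefix => j ji.
by apply: ddi; exact: leq_trans it.
Qed.

End model.

(** * Strategic measures with prescribed cylinder masses *)

Section realization.
Variable R : realType.
Local Notation M := (model R).
Local Notation H := (trajectory M).
Local Notation digits := (prod_topology (fun _ : nat => (bool * bool)%type)).

Definition start : probability (borel (state M)) R := \d_(1%N : borel (state M)).

Let dX : forall U : set (state M), open U := @discrete_open nat.
Let dA : forall U : set (action M), open U := @discrete_open bool.
Let cX : countable [set: state M] := countableP _.
Let cA : countable [set: action M] := countableP _.

(** Candidate cylinder masses: [m_cons] expresses additivity, [m_survival] the transition law, and
    [m_pi] the law of the actions. *)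
Variable m : seq (bool * bool) -> R.
Hypotheses (m_ge0 : forall s, 0 <= m s) (m_nil : m [::] = 1)
  (m_cons : forall s, m s = \sum_e m (e :: s))
  (m_survival : forall s a, m ((a, true) :: s) =
     survival R (string_state s) a * (m ((a, true) :: s) + m ((a, false) :: s))).
Variable pi : strategy M.
Hypothesis m_pi : forall (d : digits) t a,
  (m ((a, true) :: rprefix d t) + m ((a, false) :: rprefix d t))%:E =
  (pi t (history_at t (decode R d)) [set a] * (m (rprefix d t))%:E)%E.

(** The measure is the law of the decoded random digits. A history either is that of a decoded
    sequence, and its event is a cylinder, or has an empty preimage; the identities on atoms thus
    become the equations on [m]. *)
Lemma strategic_measure_realization : exists P : probability (borel H) R,
  is_strategic_measure start pi P /\
  forall s, P [set w | rprefix (encode w) (size s) = s] = (m s)%:E.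
Proof.
have [g gP] := digit_law_exists m_ge0 m_nil m_cons.
pose U : probability (measurableTypeR R) R := uniform_prob (@ltr01 R).
pose F : measurableTypeR R -> borel H := decode R \o g.
have mF : measurable_fun setT F.
  apply: (@prefix_measurable_comp (bool * bool)%type H _ _ _ g (decode R)).
  - exact: countableP.
  - by move=> s; exact: (gP s).1.
  - exact: continuous_decode.
pose P : probability (borel H) R := distribution U (mfun_Sub (mem_set mF)).
have PE B : P B = U (F @^-1` B) by [].
pose cyl s := [set u | rprefix (g u) (size s) = s].
have Ucyl s : U (cyl s) = (m s)%:E := (gP s).2.
have mcyl s : measurable (cyl s) := (gP s).1.
have cylS a c d t u : cyl ((a, c) :: rprefix d t) u <->
    rprefix (g u) t = rprefix d t /\ g u t = (a, c).
  by rewrite /cyl/= size_rprefix; split => [[-> ->]|[-> ->]].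
have U2 a d t : U (cyl ((a, true) :: rprefix d t) `|` cyl ((a, false) :: rprefix d t)) =
    (m ((a, true) :: rprefix d t) + m ((a, false) :: rprefix d t))%:E.
  rewrite measureU//; first by rewrite EFinD -!Ucyl.
  by apply/seteqP; split => u // -[/cylS[_ gu] /cylS[_]]; rewrite gu.
have Fhist t d : F @^-1` (history_at t @^-1` [set history_at t (decode R d)]) =
    cyl (rprefix d t).
  apply/seteqP; split => u /=; first by move=> /eq_history_decode; rewrite /cyl/= size_rprefix.
  by rewrite /cyl/= size_rprefix => h; exact: (eq_history_decode R t (g u) d).2 h.
(* Knowing the action leaves the survival digit free, whence two cylinders. *)
have Fact t d (a : action M) : F @^-1` (history_at t @^-1` [set history_at t (decode R d)] `&`
      action_at t @^-1` [set a]) =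
    cyl ((a, true) :: rprefix d t) `|` cyl ((a, false) :: rprefix d t).
  rewrite preimage_setI Fhist; apply/seteqP; split => u.
    rewrite {1}/cyl/= size_rprefix => -[hd <-]; case e : (g u t) => [a' []].
      by left; apply/cylS; rewrite /F/= action_at_decode e.
    by right; apply/cylS; rewrite /F/= action_at_decode e.
  by case=> /cylS[hd gu]; split; rewrite ?/cyl/= ?size_rprefix//
     /preimage/F/= action_at_decode gu.
exists P; split; last first.
  move=> s; rewrite PE -Ucyl; congr (U _); apply/seteqP.
  by split => u /=; rewrite /F/= encodeK.
apply: strategic_measureP => //.
- move=> B; rewrite PE [RHS]diracE.
  have [B1|B1] := boolP ((1%N : state M) \in B).
    rewrite (_ : _ @^-1` _ = setT) ?probability_setT//.
    by apply/seteqP; split => u // _; exact: set_mem B1.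
  rewrite (_ : _ @^-1` _ = set0) ?measure0//.
  by apply/seteqP; split => u //= Bu; move: B1; rewrite (mem_set Bu).
- move=> t h a; rewrite !PE.
  have [[d <-]|noh] := pselect (exists d, history_at t (decode R d) = h).
    by rewrite Fhist Fact U2 m_pi Ucyl.
  rewrite preimage_setI (_ : F @^-1` _ = set0) ?set0I ?measure0 ?mule0//.
  by apply/seteqP; split => u //= hu; apply: noh; exists (g u).
- move=> t h a y; rewrite !PE.
  have [[d <-]|noh] := pselect (exists d, history_at t (decode R d) = h); last first.
    rewrite !preimage_setI (_ : F @^-1` _ = set0) ?set0I ?measure0 ?mule0//.
    by apply/seteqP; split => u //= hu; apply: noh; exists (g u).
  have -> : (history_at t (decode R d)).2 = string_state (rprefix d t).
    exact: state_at_decode.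
  rewrite preimage_setI Fact U2.
  rewrite transitionE -EFinM.
  have FX u c : g u t = (a, c) -> rprefix (g u) t = rprefix d t ->
      state_at t.+1 (F u) = if c then target (string_state (rprefix d t)) a else 0%N.
    by move=> gu gd; rewrite [LHS](state_at_decode R (g u) t.+1)/= gu gd.
  (* Three cases: the next state is 0 on the digit [false], the target on the digit [true], and
     nothing else can occur. *)
  have [->|y0] := eqVneq y 0%N.
    rewrite (_ : _ `&` _ = cyl ((a, false) :: rprefix d t)).
      rewrite Ucyl; congr EFin; rewrite !indicE/= memNset ?mem_set//.
      rewrite mulr0 add0r mulr1; have := m_survival (rprefix d t) a. lra.
    apply/seteqP; split => u; last first.
      move=> uc; split; [by right|have /cylS[h1 h2] := uc].
      exact: (FX u false h2 h1).
    move=> [[uc|//] su]; have /cylS[h1 h2] := uc.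
    by have := FX u true h2 h1; rewrite [LHS]su.
  have [->|yt] := eqVneq y (target (string_state (rprefix d t)) a).
    rewrite (_ : _ `&` _ = cyl ((a, true) :: rprefix d t)).
      rewrite Ucyl; congr EFin; rewrite indicE mem_set// indicE memNset//.
      by rewrite mulr1 mulr0 addr0; exact: m_survival.
    apply/seteqP; split => u; last first.
      move=> uc; split; [by left|have /cylS[h1 h2] := uc].
      exact: (FX u true h2 h1).
    move=> [[//|uc] su]; have /cylS[h1 h2] := uc.
    by have := FX u false h2 h1; rewrite [LHS]su.
  rewrite (_ : _ `&` _ = set0).
    rewrite measure0 indicE memNset => [|/= yE]; last by rewrite yE eqxx in yt.
    rewrite indicE memNset => [|/= yE]; last by rewrite yE eqxx in y0.
    by rewrite !mulr0 addr0 mul0r.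
  apply/seteqP; split => u //.
  move=> [[|] /cylS[h1 h2] su].
    by move: yt; rewrite -(FX u true h2 h1) (_ : state_at t.+1 (F u) = y) ?eqxx.
  by move: y0; rewrite -(FX u false h2 h1) (_ : state_at t.+1 (F u) = y) ?eqxx.
Qed.

End realization.

(** * From strategies to cylinder masses and back *)

Section strategic_measure_existence.
Variable R : realType.
Local Notation M := (model R).
Local Notation H := (trajectory M).
Local Notation digits := (prod_topology (fun _ : nat => (bool * bool)%type)).

Lemma big_bool_pair (f : bool * bool -> R) : \sum_e f e =
  (f (true, true) + f (true, false)) + (f (false, true) + f (false, false)).
Proof.
rewrite (eq_bigr (fun e => f (e.1, e.2))); last by case.
by rewrite -(pair_bigA _ (fun a c => f (a, c)))/= big_bool !big_bool.
Qed.

Lemma deterministic_strategic_measure_exists (phi : borel nat -> borel bool)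
    (mphi : measurable_fun [set: borel nat] phi) :
  exists P : probability (borel H) R,
    is_strategic_measure (start R) (@deterministic_stationary R M phi mphi) P.
Proof.
(* The Ionescu-Tulcea product along the string: an action other than that of [phi] has weight 0, the
   right one contributes the probability of survival or absorption. *)
pose m := fix m (s : seq (bool * bool)) : R :=
  if s is (a, c) :: s' then m s' * (if a == phi (string_state s') then
    if c then survival R (string_state s') a else 1 - survival R (string_state s') a
    else 0) else 1.
have m_ge0 s : 0 <= m s.
  elim: s => //= -[a c] s IH; apply: mulr_ge0 => //; case: ifP => // _.
  by have /andP[? ?] := survival01 R (string_state s) a; case: c; rewrite ?subr_ge0.
have m_cons s : m s = \sum_e m (e :: s).
  by rewrite big_bool_pair/=; case: (phi (string_state s)) => /=; lra.
have m_survival s a : m ((a, true) :: s) =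
    survival R (string_state s) a * (m ((a, true) :: s) + m ((a, false) :: s)).
  by rewrite /=; case: ifP => _; lra.
have m_pi (d : digits) t a :
  (m ((a, true) :: rprefix d t) + m ((a, false) :: rprefix d t))%:E =
  (@deterministic_stationary R M phi mphi t (history_at t (decode R d)) [set a] *
  (m (rprefix d t))%:E)%E.
  rewrite [X in (X * _)%E](_ : _ = (a == phi (string_state (rprefix d t)))%:R%:E).
    by rewrite -EFinM/=; congr EFin; case: (a == _) => /=; rewrite ?mulr0 ?mul0r ?addr0 ?mul1r//; lra.
  rewrite -(state_at_decode R d t) [LHS]diracE.
  by congr ((nat_of_bool _)%:R%:E); apply/idP/eqP => [/set_mem <-//|->]; exact: mem_set.
have [P [sP _]] := strategic_measure_realization m_ge0 erefl m_cons m_survival m_pi.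
by exists P.
Qed.

(** The strategy climbs with the conditional probability of climbing given the string. If the string
    has mass 0, so do its extensions, and both sides vanish. *)
Lemma strategy_realization (m : seq (bool * bool) -> R) :
  (forall s, 0 <= m s) -> (forall s, m s = \sum_e m (e :: s)) ->
  exists pi : strategy M, forall (d : digits) t a,
    (m ((a, true) :: rprefix d t) + m ((a, false) :: rprefix d t))%:E =
    (pi t (history_at t (decode R d)) [set a] * (m (rprefix d t))%:E)%E.
Proof.
move=> m_ge0 m_cons.
pose ratio s := (m ((true, true) :: s) + m ((true, false) :: s)) / m s.
have mE s := etrans (m_cons s) (big_bool_pair (fun e => m (e :: s))).
have ratio01 s : 0 <= ratio s <= 1.
  apply/andP; split; first by rewrite divr_ge0// addr_ge0.
  rewrite /ratio; have [ms0|ms0] := eqVneq (m s) 0.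
    by rewrite ms0 invr0 mulr0 ler01.
  rewrite ler_pdivrMr ?lt_def ?ms0//= mul1r (mE s).
  by rewrite lerDl addr_ge0.
have ratioE s : ratio s * m s = m ((true, true) :: s) + m ((true, false) :: s).
  have [ms0|ms0] := eqVneq (m s) 0; last by rewrite /ratio divfK.
  have := m_ge0 ((true, true) :: s); have := m_ge0 ((true, false) :: s).
  have := m_ge0 ((false, true) :: s); have := m_ge0 ((false, false) :: s).
  by have := mE s; rewrite ms0; lra.
(* The default 0, on histories that no digits produce, means staying. The choice of [d] is harmless,
   as the history determines the prefix. *)
pose q t (h : history M t) := if pselect (exists d, history_at t (decode R d) = h)
  is left e then ratio (rprefix (projT1 (cid e)) t) else 0.
have q01 t h : 0 <= q t h <= 1.
  by rewrite /q; case: pselect => [e|_]; [exact: ratio01|rewrite lexx ler01].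
have qE t d : q t (history_at t (decode R d)) = ratio (rprefix d t).
  rewrite /q; case: pselect => [e|[]]; last by exists d.
  by case: cid => d' /= /eq_history_decode ->.
have dh t (U : set (history M t)) : open U.
  by apply: discrete_history => V; exact: discrete_open.
have k t := cid (@mixture_kernel_exists R _ bool (q t) (fun=> true) (fun=> false) (dh t) (q01 t)).
exists (fun t => projT1 (k t)) => d t a.
rewrite (projT2 (k t)) qE -EFinM; congr EFin; rewrite !indicE.
case: a; [rewrite mem_set// memNset//|rewrite memNset// mem_set//].
  by rewrite mulr0 addr0 mulr1 ratioE.
rewrite mulr0 add0r mulr1; have := ratioE (rprefix d t); have := mE (rprefix d t).
lra.
Qed.

End strategic_measure_existence.

(** * Compactness of the strategic measures *)

Section almost_sure_approximation.
Context d (W : measurableType d) (R : realType) (P : probability W R).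

Lemma Rintegral_partition (I : finType) (k : W -> I) (c : I -> R) :
  (forall i, measurable (k @^-1` [set i])) ->
  (\int[P]_w c (k w))%R = \sum_i c i * fine (P (k @^-1` [set i])).
Proof.
move=> mk.
have cE w : (c (k w))%:E = (\sum_i (c i)%:E * (\1_(k @^-1` [set i]) w)%:E)%E.
  rewrite (bigD1 (k w))//= indicE mem_set// mule1 big1 ?adde0// => i ik.
  by rewrite indicE memNset ?mule0// => /= ki; rewrite ki eqxx in ik.
have iI i : P.-integrable setT (EFin \o (\1_(k @^-1` [set i]) : W -> R)).
  exact: integrable_indic.
rewrite /Rintegral; under eq_integral do rewrite cE.
rewrite integral_sum//; last by move=> i; apply: integrableZl; [exact: measurableT|exact: iI].
rewrite (eq_bigr (fun i => (c i * fine (P (k @^-1` [set i])))%:E)).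
  by rewrite sumEFin.
move=> i _; rewrite integralZl//; last exact: iI.
have -> : (\int[P]_w (\1_(k @^-1` [set i]) w)%:E = P (k @^-1` [set i]))%E.
  by rewrite integral_indic// setIT.
by rewrite EFinM fineK//; exact: fin_num_measure.
Qed.

Lemma Rintegral_approx (L : set W) (f g : W -> R) (e : R) :
  measurable L -> P (~` L) = 0%E ->
  measurable_fun setT f -> bounded_fun f ->
  measurable_fun setT g -> bounded_fun g ->
  (forall w, L w -> `|f w - g w| <= e) -> 0 <= e ->
  `|(\int[P]_w f w)%R - (\int[P]_w g w)%R| <= e.
Proof.
move=> mL PL mf bf mg bg fg e0.
have PT : (P setT < +oo)%E by rewrite probability_setT ltry.
have intf : P.-integrable setT (EFin \o f) by exact: measurable_bounded_integrable.
have intg : P.-integrable setT (EFin \o g) by exact: measurable_bounded_integrable.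
have inth : P.-integrable setT (EFin \o (fun w => f w - g w)).
  by apply: eq_integrable (integrableB _ intf intg).
rewrite -RintegralB// /Rintegral (@negligible_integral _ _ _ _ _ (~` L))//; last exact: measurableC.
rewrite setDE setTI setCK.
have inthL : P.-integrable L (EFin \o (fun w => f w - g w)).
  by apply: integrableS inth.
apply: (le_trans (le_normr_Rintegral mL inthL)).
apply: (@le_trans _ _ (\int[P]_(w in L) e)%R).
  apply: le_Rintegral => //.
  - exact: integrable_norm.
  - apply: measurable_bounded_integrable => //; last exact: bounded_cst.
    exact: le_lt_trans (probability_le1 P mL) (ltry _).
rewrite Rintegral_cst// ler_piMr// -lee_fin fineK ?probability_le1//.
exact: fin_num_measure.
Qed.

End almost_sure_approximation.

(** * Cylinder masses of a strategic measure *)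

Section strategic_measures_of_model.
Variable R : realType.
Local Notation M := (model R).
Local Notation H := (trajectory M).
Local Notation digits := (prod_topology (fun _ : nat => (bool * bool)%type)).

Let dX : forall U : set (state M), open U := @discrete_open nat.
Let dA : forall U : set (action M), open U := @discrete_open bool.

Definition cylinder (s : seq (bool * bool)) : set (borel H) :=
  [set w | rprefix (encode w) (size s) = s].

Lemma nonanticipating_encode t (Q : set (seq (bool * bool))) :
  nonanticipating t [set w : H | Q (rprefix (encode w) t)].
Proof.
move=> w w' /eq_history_at[hs ha]/=.
rewrite (_ : rprefix (encode w') t = rprefix (encode w) t)//.
by apply/eq_rprefix => i it; rewrite /encode hs// ha.
Qed.

Lemma measurable_cylinder s : measurable (cylinder s).
Proof.
apply: (measurable_nonanticipating dX dA (t := size s)).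
exact: (@nonanticipating_encode _ [set s]).
Qed.

Lemma measurable_legal : measurable (legal (R := R) : set (borel H)).
Proof.
have -> : legal (R := R) = [set w : H | state_at 0 w = 1%N] `&` \bigcap_t
    [set w : H | state_at t.+1 w = 0%N \/ state_at t.+1 w = target (state_at t w) (action_at t w)].
  by apply/seteqP; split => w [w0 wS]; split => // t; have := wS t; [|apply].
apply: measurableI; first exact: (measurable_state_at dX 0 [set 1%N]).
apply: bigcapT_measurable => t; apply: (measurable_nonanticipating dX dA (t := t.+1)).
by move=> w w' /eq_history_at[hs ha]; rewrite /mkset (hs t)// (hs t.+1)// ha.
Qed.

Section one_measure.
Variables (pi : strategy M) (P : probability (borel H) R).
Hypothesis sP : is_strategic_measure (start R) pi P.

(** An illegal trajectory starts elsewhere than in 1, or at some time moves from some state under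
    some action to neither 0 nor the target: a countable union of null events. *)
Lemma legal_almost_surely : P (~` legal (R := R)) = 0%E.
Proof.
have mnl : measurable (~` legal (R := R) : set (borel H)).
  by apply: measurableC; exact: measurable_legal.
apply/(negligibleP _ mnl).
pose bad t x a := [set w : H | state_at t w = x] `&` action_at t @^-1` [set a] `&`
  state_at t.+1 @^-1` (~` [set (0%N : state M); target x a]).
have bad0 t x a : P.-negligible (bad t x a).
  have mbad : measurable (bad t x a : set (borel H)).
    apply: measurableI; last exact: measurable_state_at.
    apply: measurableI; last exact: measurable_action_at.
    exact: (measurable_state_at dX t [set x]).
  apply/(negligibleP _ mbad).
  have nE : nonanticipating t [set w : H | state_at t w = x].
    by move=> w w' /eq_history_at[hs _]; rewrite /mkset hs.
  apply: (etrans (strategic_transition dX dA sP nE (fun _ => id) a _)).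
  rewrite transitionE !indicE memNset/=; last by case; right.
  by rewrite memNset/=; [rewrite !mulr0 addr0 mul0e|case; left].
have st0 : P.-negligible (@state_at R M 0 @^-1` (~` [set (1%N : state M)])).
  apply/negligibleP; last first.
  have [sP0 _ _] := sP; apply: (etrans (sP0 _ _)); first exact: discrete_measurable.
  by rewrite [LHS]diracE memNset//= => /(_ erefl).
  exact: measurable_state_at.
have [N [mN PN badN]] : P.-negligible ((@state_at R M 0 @^-1` (~` [set (1%N : state M)])) `|`
    \bigcup_t \bigcup_x (bad t x true `|` bad t x false)).
  apply: negligibleU => //; apply: negligible_bigcup => t.
  by apply: negligible_bigcup => x; exact: negligibleU.
exists N; split => //; apply: subset_trans badN => w nw.
apply: contrapT => h; apply: nw; split.
  by apply: contrapT => w0; apply: h; left.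
move=> t; apply: contrapT => /not_orP[h1 h2]; apply: h; right.
exists t => //; exists (state_at t w) => //.
by case e : (action_at t w); [left|right]; split => //= -[|]; rewrite -?e.
Qed.

Lemma eq_legal_measure (A B : set (borel H)) : measurable A -> measurable B ->
  A `&` legal (R := R) = B `&` legal (R := R) -> P A = P B.
Proof.
move=> mA mB AB; have mL := measurable_legal.
have E C : measurable C -> P C = P (C `&` legal (R := R)).
  move=> mC; have E0 : P (C `\` legal (R := R)) = 0%E.
    apply: (subset_measure0 _ _ _ legal_almost_surely); first exact: measurableD.
      exact: measurableC.
    by move=> w [].
  rewrite -[in LHS](setUIDK C (legal (R := R))) measureU.
  - by rewrite [X in (_ + X)%E]E0 adde0.
  - exact: measurableI.
  - exact: measurableD.
  - by apply/seteqP; split => w // [[_ ?] []].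
by rewrite E// AB -E.
Qed.

Definition cylinder_mass s : R := fine (P (cylinder s)).

Lemma cylinder_massE s : P (cylinder s) = (cylinder_mass s)%:E.
Proof. by rewrite /cylinder_mass fineK// fin_num_measure//; exact: measurable_cylinder. Qed.

Lemma cylinder_mass_ge0 s : 0 <= cylinder_mass s.
Proof. exact: fine_ge0. Qed.

Lemma cylinder_mass_le1 s : cylinder_mass s <= 1.
Proof. by rewrite -lee_fin -cylinder_massE probability_le1//; exact: measurable_cylinder. Qed.

Lemma cylinder_mass_nil : cylinder_mass [::] = 1.
Proof.
by rewrite /cylinder_mass (_ : cylinder _ = setT) ?probability_setT//; apply/seteqP.
Qed.

Lemma cylinder_cons s (a c : bool) : cylinder ((a, c) :: s) =
  cylinder s `&` (@action_at R M (size s) @^-1` [set a]) `&`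
  [set w : H | (state_at (size s).+1 w != 0%N) = c].
Proof.
apply/seteqP; split => w; rewrite /cylinder/=; first by move=> [<- <- ->].
by move=> [[cs aw] sw]; congr ((_, _) :: _).
Qed.

Lemma cylinder_mass_action s (a : bool) :
  P (cylinder s `&` (@action_at R M (size s) @^-1` [set a])) =
  (cylinder_mass ((a, true) :: s) + cylinder_mass ((a, false) :: s))%:E.
Proof.
rewrite EFinD -!cylinder_massE -measureU; [|exact: measurable_cylinder..|]; last first.
  by apply/seteqP; split => w // [] ; rewrite !cylinder_cons => -[_ /= ->] [].
congr (P _); rewrite !cylinder_cons; apply/seteqP; split => w; last by case=> -[].
by move=> h; case e : (state_at (size s).+1 w != 0%N); [left|right].
Qed.

Lemma cylinder_mass_cons s : cylinder_mass s = \sum_e cylinder_mass (e :: s).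
Proof.
rewrite big_bool_pair; apply: EFin_inj; rewrite EFinD -!cylinder_mass_action.
rewrite -cylinder_massE -measureU.
- congr (P _); apply/seteqP; split => w; last by case=> -[].
  by move=> h; case e : (action_at (size s) w); [left|right].
- by apply: measurableI; [exact: measurable_cylinder|exact: measurable_action_at].
- by apply: measurableI; [exact: measurable_cylinder|exact: measurable_action_at].
- by apply/seteqP; split => w // [] [_ /= ->] [].
Qed.

(** The transition law, in a form that does not mention the strategy and therefore passes to limits
    of strategic measures. *)
Lemma cylinder_mass_survival s a : cylinder_mass ((a, true) :: s) =
  survival R (string_state s) a *
  (cylinder_mass ((a, true) :: s) + cylinder_mass ((a, false) :: s)).
Proof.
apply: EFin_inj; rewrite EFinM -cylinder_mass_action -cylinder_massE cylinder_cons.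
pose x : state M := string_state s.
have Ex w : legal w -> cylinder s w -> state_at (size s) w = x.
  by move=> lw cs; have := state_at_decode R (encode w) (size s); rewrite (decodeK lw) cs.
(* Fixing the current state makes the transition probability constant; on legal trajectories the
   cylinder already fixes it, so no mass is lost. *)
pose E := cylinder s `&` (@state_at R M (size s) @^-1` [set x]).
have nE : nonanticipating (size s) E.
  move=> w w' hh [h1 h2]; split; first exact: (@nonanticipating_encode _ [set s] _ _ hh).
  by have /eq_history_at[hs _] := hh; rewrite /= -hs.
have mE := measurable_nonanticipating dX dA nE.
have mA U : measurable (@action_at R M (size s) @^-1` U : set (borel H)).
  exact: measurable_action_at.
have mS U : measurable (@state_at R M (size s).+1 @^-1` U : set (borel H)).
  exact: measurable_state_at.
have EX : E `<=` state_at (size s) @^-1` [set x] by move=> w [].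
have := strategic_transition dX dA sP nE EX a (~` [set (0%N : state M)]).
rewrite transitionE !indicE mem_set//= memNset/=; last exact.
rewrite mulr1 mulr0 addr0 => H1.
have cE : cylinder s `&` legal (R := R) = E `&` legal (R := R).
  apply/seteqP; split => w; first by move=> [cs lw]; split => //; split => //; exact: Ex.
  by move=> [[]].
transitivity (P (E `&` @action_at R M (size s) @^-1` [set a] `&`
    state_at (size s).+1 @^-1` (~` [set (0%N : state M)]))).
  apply: eq_legal_measure.
  - apply: measurableI; last exact: (mS [set y | (y != 0%N) = true]).
    by apply: measurableI => //; exact: measurable_cylinder.
  - by apply: measurableI => //; exact: measurableI.
  apply/seteqP; split => w.
    by move=> [[[cs aw] /eqP sw] lw]; do !split => //; exact: Ex.
  by move=> [[[[cs _] aw] /eqP sw] lw].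
rewrite H1; congr (_ * _)%E; apply: eq_legal_measure.
- exact: measurableI.
- by apply: measurableI => //; exact: measurable_cylinder.
by rewrite setIAC -cE setIAC.
Qed.

End one_measure.
End strategic_measures_of_model.

Lemma continuous_real_measurable (R : realType) (T : ptopologicalType) (f : T -> R) :
  continuous f -> measurable_fun [set: borel T] (f : borel T -> R).
Proof.
move=> cf; apply: (measurability _ (RGenOpens.measurableE R)).
move=> _ [_ [a [b ->] <-]]; rewrite setTI; apply: sub_sigma_algebra.
by apply: open_comp => [x _|]; [exact: cf|exact: interval_open].
Qed.

(** * Limits along ultrafilters of strategic measures *)

Section compactness.
Variable R : realType.
Local Notation M := (model R).
Local Notation H := (trajectory M).
Local Notation digits := (prod_topology (fun _ : nat => (bool * bool)%type)).

Lemma rprefix_nth (T : Type) (x0 : T) (s : seq T) : rprefix (nth x0 (rev s)) (size s) = s.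
Proof.
have rprefixE d t : rprefix d t = rev (mkseq d t) :> seq T.
  by elim: t => //= t ->; rewrite mkseqS rev_rcons.
by rewrite rprefixE -(size_rev s) mkseq_nth revK.
Qed.

Lemma digits_compact : compact [set: (bool * bool)%type].
Proof. exact/finite_compact/finite_finset. Qed.

(** On legal trajectories [f] depends, up to [e], on the first [t] digits only. Neither [t] nor the
    weights [c] depend on the measure, so convergence on cylinders implies weak convergence. *)
Lemma Rintegral_cylinder_approx (f : H -> R) (e : R) :
  continuous f -> bounded_fun f -> 0 < e ->
  exists t (c : t.-tuple (bool * bool) -> R), forall pi P,
    is_strategic_measure (start R) pi P ->
    `|(\int[P]_w f w)%R - \sum_s c s * cylinder_mass P s| <= e.
Proof.
move=> cf bf e0.
have cfd : continuous (f \o decode R : digits -> R).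
  by move=> d; apply: continuous_comp; [exact: continuous_decode|exact: cf].
have [t tP] := seq_continuous_approx discrete_bool_bool digits_compact cfd e0.
pose k (w : borel H) : t.-tuple (bool * bool) := tcast (size_rprefix (encode w) t) (in_tuple _).
have kE w : k w = rprefix (encode w) t :> seq _ by rewrite val_tcast.
(* The value of [f] at one continuation of [s]: the string is reversed into chronological order and
   padded with an arbitrary digit. *)
pose c (s : t.-tuple (bool * bool)) := f (decode R (nth (true, true) (rev s))).
have kc s : k @^-1` [set s] = cylinder s.
  apply/seteqP; split => w; rewrite /cylinder/= size_tuple; first by move=> <-.
  by move=> ws; apply: val_inj; rewrite /= kE.
exists t, c => pi P sP.
have mk s : measurable (k @^-1` [set s]) by rewrite kc; exact: measurable_cylinder.
rewrite (eq_bigr (fun s => c s * fine (P (k @^-1` [set s])))); last by move=> s _; rewrite kc.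
rewrite -(@Rintegral_partition _ _ _ P _ k c mk).
apply: (@Rintegral_approx _ _ _ P (legal (R := R))) => //.
- exact: measurable_legal.
- exact: legal_almost_surely sP.
- exact: continuous_real_measurable.
- move=> _ B _; rewrite setTI.
  rewrite (_ : _ @^-1` B = \bigcup_(s in c @^-1` B) (k @^-1` [set s])).
    by apply: fin_bigcup_measurable => //; exact: finite_finset.
  apply/seteqP; split => w; first by exists (k w).
  by move=> [s Bs ks]; rewrite /preimage/= ks.
- case: bf => N [Nr fN]; exists N; split => // x Nx w _; exact: fN.
- move=> w lw; rewrite -{1}(decodeK lw); apply/ltW/tP.
  by have := rprefix_nth (true, true) (k w); rewrite size_tuple => ->; rewrite kE.
- exact: ltW.
Qed.

(** Tychonoff's theorem on the cube of cylinder masses gives convergence on cylinders, and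
    [Rintegral_cylinder_approx] upgrades it to weak convergence. *)
Lemma strategic_measures_compact : compact (@strategic_measures R M (start R)).
Proof.
rewrite compact_ultra => F FU FS.
pose Phi (P : weak_probabilities R H) : prod_topology (fun _ : seq (bool * bool) => R) :=
  cylinder_mass P.
have cK : compact [set m : prod_topology (fun _ : seq (bool * bool) => R) |
    forall s, `[0 : R, 1]%classic (m s)].
  exact: (@tychonoff _ (fun=> R) (fun=> `[0 : R, 1]%classic) (fun=> @segment_compact R 0 1)).
have [m m01 Fm] : exists2 m : prod_topology (fun _ : seq (bool * bool) => R),
    (forall s, `[0 : R, 1]%classic (m s)) & Phi @ F --> m.
  apply: (ultra_cvg_compact FU cK); apply: filterS FS => P _ s /=.
  by rewrite in_itv/= cylinder_mass_ge0 cylinder_mass_le1.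
have Fms s : (fun P : weak_probabilities R H => cylinder_mass P s) @ F --> m s.
  exact: (cvg_comp _ _ Fm (@proj_continuous _ (fun=> R) s m)).
(* An equation satisfied by all strategic measures is inherited by the limit masses. *)
have lim_eq (u v : weak_probabilities R H -> R) (a b : R) :
    (forall P, strategic_measures (start R) P -> u P = v P) ->
    u @ F --> a -> v @ F --> b -> a = b.
  move=> uv ua vb; apply: (@cvg_unique _ (@Rhausdorff R) (u @ F)) => //.
  apply: cvg_trans vb; apply: near_eq_cvg.
  by apply: filterS FS => P /uv.
have m_nil : m [::] = 1.
  apply: (lim_eq _ (cst 1) _ _ _ (Fms [::])); last exact: cvg_cst.
  by move=> P _; exact: cylinder_mass_nil.
have m_cons s : m s = \sum_e m (e :: s).
  rewrite big_bool_pair; apply: (lim_eq _ _ _ _ _ (Fms s)); last first.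
    by apply: cvgD; apply: cvgD; exact: Fms.
  by move=> P _; rewrite /= [LHS]cylinder_mass_cons big_bool_pair.
have m_survival s a : m ((a, true) :: s) =
    survival R (string_state s) a * (m ((a, true) :: s) + m ((a, false) :: s)).
  apply: (lim_eq _ _ _ _ _ (Fms ((a, true) :: s))); last first.
    by apply: cvgMr; apply: cvgD; exact: Fms.
  by move=> P [pi sP]; rewrite /= [LHS](cylinder_mass_survival sP).
have m_ge0 s : 0 <= m s by have := m01 s; rewrite /= in_itv/= => /andP[].
(* No limit of strategies is taken; the strategy is read off the limit masses. *)
have [pi m_pi] := strategy_realization m_ge0 m_cons.
have [P [sP Pm]] := strategic_measure_realization m_ge0 m_nil m_cons m_survival m_pi.
exists (P : weak_probabilities R H); split; first by exists pi.
apply: (@cvg_initial _ _ _ _ F id) => /=.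
apply: cvg_product => -[f [cf bf]].
apply/cvgrPdist_le => e e0.
(* One third for the approximation under [P], one under [Q], and one for the convergence of the
   finite sums. *)
have e30 : 0 < e / 3 by rewrite divr_gt0.
have [t [c tcP]] := Rintegral_cylinder_approx cf bf e30.
have Fc : (fun Q : weak_probabilities R H => \sum_s c s * cylinder_mass Q s) @ F -->
    \sum_s c s * cylinder_mass P s.
  apply: cvg_big => [|s _]; first exact: add_continuous.
  apply: cvgMr.
  by have := Fms s; rewrite /cylinder_mass [X in fine X](Pm s).
have := FS; apply: filterS2 ((cvgrPdist_le _ _).1 Fc _ e30) => Q Qc [piQ sQ] /=.
have h1 := tcP _ _ sP; have h2 := tcP _ _ sQ.
rewrite -(subrKA (\sum_s c s * cylinder_mass P s)).
apply: (le_trans (ler_normD _ _)).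
rewrite -[X in _ + `|X|](subrKA (\sum_s c s * cylinder_mass Q s)).
apply: (@le_trans _ _ (e / 3 + (e / 3 + e / 3))); last by lra.
apply: lerD => //; apply: (le_trans (ler_normD _ _)); apply: lerD => //.
by rewrite distrC.
Qed.

End compactness.

(** * Absorption *)

Section hitting_times.
Local Open Scope ereal_scope.
Variables (R : realType) (M : mdp R).
Local Notation H := (trajectory M).
Variable z : state M.

Lemma lt_hitting_time s t (w : H) :
  (t%:R%:E < hitting_time z s w) = `[< forall i, (s <= i <= t)%N -> state_at i w <> z >].
Proof.
apply/idP/asboolP => [tT i /andP[si it] wi|h].
  move: tT; rewrite ltNge => /negP; apply; apply: (@le_trans _ _ i%:R%:E).
    by apply: ereal_inf_lbound; exists i.
  by rewrite lee_fin ler_nat.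
apply: (@lt_le_trans _ _ t.+1%:R%:E); first by rewrite lte_fin ltr_nat.
apply: le_ereal_inf_tmp => _ [i [si wi] <-]; rewrite lee_fin ler_nat ltnNge.
by apply/negP => it; apply: (h i) wi; rewrite si.
Qed.

(** If the first visit to [z] is at time [k], exactly the first [k] terms of the series are 1; if
    there is none, all terms are 1 and both sides are infinite. *)
Lemma hitting_time_tail (w : H) : hitting_time z 0 w = tail_time z 0 w.
Proof.
rewrite /tail_time.
have t0 t : 0 <= ((t%:R%:E < hitting_time z 0 w)%E%:R%:E : \bar R) by rewrite lee_fin.
have sum1 n : (forall i, (i < n)%N -> state_at i w <> z) ->
    \sum_(0 <= t < n) ((t%:R%:E < hitting_time z 0 w)%E%:R%:E : \bar R) = n%:R%:E.
  move=> h; rewrite (eq_big_nat _ _ (F2 := fun=> 1%:E)); last first.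
    move=> t /andP[_ tn]; rewrite lt_hitting_time; case: asboolP => // -[] i /andP[_ it].
    by apply: h; exact: leq_ltn_trans tn.
  by rewrite sumEFin big_const_nat subn0 iter_addr_0.
have [ex|nex] := pselect (exists t, `[< state_at t w = z >]); last first.
  have nz i : state_at i w <> z by move=> wi; apply: nex; exists i; exact/asboolP.
  have Ty : hitting_time z 0 w = +oo.
    by apply/eqP; rewrite -leye_eq; apply: le_ereal_inf_tmp => x [i [_ wi] _]; case: (nz i wi).
  rewrite [LHS]Ty; apply/esym/eqyP => A A0; apply: (@le_trans _ _ (Num.bound A)%:R%:E).
    by rewrite lee_fin ltW// archi_boundP// ltW.
  rewrite -(sum1 (Num.bound A)) => [|i _]; last exact: nz.
  by apply: nneseries_lim_ge => t _ _.
have [k /asboolP wk kmin] := ex_minnP ex.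
have nz i : (i < k)%N -> state_at i w <> z.
  by move=> ik /asboolP/kmin; rewrite leqNgt ik.
have Tk : hitting_time z 0 w = k%:R%:E.
  apply/eqP; rewrite eq_le; apply/andP; split; first by apply: ereal_inf_lbound; exists k.
  apply: le_ereal_inf_tmp => _ [i [_ /asboolP wi] <-]; rewrite lee_fin ler_nat.
  exact: kmin.
rewrite (nneseries_split 0 k)// add0n sum1// eseries0 ?adde0// => i ki _.
by rewrite Tk lte_fin ltr_nat ltnNge ki.
Qed.

End hitting_times.

(** * Drift of the potential and expected absorption time *)

Section drift.
Local Open Scope ereal_scope.
Variable R : realType.
Local Notation M := (model R).
Local Notation H := (trajectory M).

Let dX : forall U : set (state M), open U := @discrete_open nat.
Let dA : forall U : set (action M), open U := @discrete_open bool.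

Lemma measurable_coordinates d (S : measurableType d) (h : nat -> bool -> S) t :
  measurable_fun [set: borel H] ((fun w : H => h (state_at t w) (action_at t w)) : borel H -> S).
Proof.
move=> _ B _; rewrite setTI; apply: (measurable_nonanticipating dX dA (t := t.+1)).
by move=> w w' /eq_history_at[hs ha]; rewrite /preimage/mkset hs// ha.
Qed.

Lemma nneseries_delta (f : nat -> \bar R) n : (forall k, 0 <= f k) ->
  (forall k, k != n -> f k = 0) -> \sum_(0 <= k <oo) f k = f n.
Proof.
move=> f0 fn; rewrite (nneseriesD1 (n := n))// eseries0 ?adde0// => k _ /= kn.
exact: fn.
Qed.

Lemma measurable_lt_hitting_time s t :
  measurable ([set w : H | t%:R%:E < hitting_time (0%N : state M) s w] : set (borel H)).
Proof.
apply: (measurable_nonanticipating dX dA (t := t)) => w w' /eq_history_at[hs _].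
rewrite /mkset !lt_hitting_time => /asboolP h; apply/asboolP => i /andP[si it].
by rewrite -hs//; apply: h; rewrite si.
Qed.

Lemma expected_tail_time (P : probability (borel H) R) n :
  \int[P]_w tail_time (0%N : state M) n w =
  \sum_(n <= t <oo) P [set w : H | t%:R%:E < hitting_time (0%N : state M) 0 w].
Proof.
under eq_integral do rewrite /tail_time -nneseries_addn//.
rewrite -nneseries_addn//.
pose D t : set (borel H) := [set w : H | t%:R%:E < hitting_time (0%N : state M) 0 w].
have DE t w : (t%:R%:E < hitting_time (0%N : state M) 0 w)%E%:R = \1_(D t) w :> R.
  by rewrite indicE; congr ((nat_of_bool _)%:R); apply/idP/idP => [h|/set_mem//]; exact: mem_set.
have mD t : measurable (D t) := measurable_lt_hitting_time 0 t.
under eq_integral do under eq_eseriesr do rewrite DE.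
rewrite integral_nneseries//.
  apply: eq_eseriesr => t _; rewrite integral_indic ?setIT//; exact: mD.
by move=> t; exact/measurable_EFinP/measurable_indic.
Qed.

Variables (pi : strategy M) (P : probability (borel H) R).
Hypothesis sP : is_strategic_measure (start R) pi P.

(** The integral is expanded over the values of the next state and the transition law is applied to
    each. As [g] vanishes at 0, only the target contributes. *)
Lemma expectation_next (g : nat -> R) t : (forall x, 0 <= g x)%R -> g 0%N = 0%R ->
  \int[P]_w (g (state_at t.+1 w))%:E =
  \int[P]_w (survival R (state_at t w) (action_at t w) *
             g (target (state_at t w) (action_at t w)))%:E.
Proof.
move=> g0 g00.
pose k y (w : borel H) : \bar R := (g y)%:E * (\1_(@state_at R M t.+1 @^-1` [set y]) w)%:E.
have k0 y w : 0 <= k y w by rewrite /k -EFinM lee_fin mulr_ge0.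
have mS y : measurable (@state_at R M t.+1 @^-1` [set y] : set (borel H)).
  exact: measurable_state_at.
have m1 y : measurable_fun setT (fun w : borel H => (\1_(@state_at R M t.+1 @^-1` [set y]) w)%:E : \bar R).
  exact/measurable_EFinP/measurable_indic.
have mk y : measurable_fun setT (k y) by exact: measurable_funeM.
have step y : \int[P]_w (k y w) = \int[P]_w ((g y)%:E *
    transition M (state_at t w, action_at t w) [set y]).
  rewrite ge0_integralZl//; last by rewrite lee_fin.
  rewrite ge0_integralZl//; last 2 first.
  - exact: (@measurable_coordinates _ _ (fun x a => transition M (x, a) [set y])).
  - by rewrite lee_fin.
  congr (_ * _); rewrite integral_indic// setIT.
  have [_ _ sP3] := sP; have := sP3 t setT [set y].
  rewrite (_ : [set w : H | setT (history_at t w, action_at t w) /\ [set (y : state M)] (state_at t.+1 w)] =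
    @state_at R M t.+1 @^-1` [set y]); last by apply/seteqP; split => w //= -[].
  rewrite (_ : [set w : H | setT (history_at t w, action_at t w)] = setT); last by apply/seteqP.
  apply; last exact: discrete_measurable.
  apply: discrete_measurable => V.
  exact: (@discrete_prod (history M t) (action M) (discrete_history dX dA (t := t)) dA V).
transitivity (\int[P]_w (\sum_(0 <= y <oo) k y w)).
  apply: eq_integral => w _; rewrite (nneseries_delta (n := state_at t.+1 w))//.
    by rewrite /k indicE mem_set// mule1.
  by move=> y yw; rewrite /k indicE memNset ?mule0// => h; case/eqP: yw; exact: esym h.
rewrite integral_nneseries//.
rewrite (eq_eseriesr (fun y _ => step y)) -integral_nneseries//; last 2 first.
- by move=> y; exact: (@measurable_coordinates _ _ (fun x a => (g y)%:E * transition M (x, a) [set y])).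
- by move=> y w _; rewrite mule_ge0// lee_fin.
apply: eq_integral => w _.
set x := state_at t w; set a := action_at t w.
rewrite (nneseries_delta (n := target x a)).
- rewrite transitionE !indicE mem_set// memNset//=.
  by rewrite mulr1 mulr0 addr0 -EFinM mulrC.
- by move=> y; rewrite mule_ge0// lee_fin.
move=> y yt; rewrite transitionE.
have [->|y0] := eqVneq y 0%N; first by rewrite g00 mul0e.
rewrite !indicE !memNset ?mulr0 ?addr0 ?mule0//= => h; first by rewrite h eqxx in y0.
by rewrite h eqxx in yt.
Qed.

(* An upper bound, uniform in the strategy, for the expected absorption time. *)
Definition potential (x : nat) : R := if x == 0%N then 0%R else (2 ^+ x + 2)%R.

Lemma potential_ge0 x : (0 <= potential x)%R.
Proof. by rewrite /potential; case: eqP => // _; rewrite addr_ge0// exprn_ge0. Qed.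

(** At a nonzero [x], climbing gives equality, since half of [2^(x+1) + 2] is [2^x + 1]; staying
    leaves a slack of [2 * 2^-x]. *)
Lemma potential_drift x a :
  ((x != 0%N)%:R + survival R x a * potential (target x a) <= potential x)%R.
Proof.
rewrite /survival /potential /target/=; case: x => [|x]/=; first by rewrite mul0r addr0.
case: a => /=.
  by rewrite (exprS _ x.+1); lra.
have : ((2^-1 : R) ^+ x.+1 * 2 ^+ x.+1 = 1)%R by rewrite -exprMn mulVf// expr1n.
have : (0 <= (2^-1 : R) ^+ x.+1)%R by apply: exprn_ge0; lra.
set u := (_ ^+ _)%R; set v := (2 ^+ _)%R => u0 uv.
have -> : ((1 - u) * (v + 2) = v + 2 - 2 * u - u * v)%R by ring.
rewrite uv; lra.
Qed.

(** The drift inequality telescopes, and 4 is the potential of the initial state 1. *)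
Lemma survival_series_le : \sum_(0 <= t <oo) P [set w : H | state_at t w != 0%N] <= 4%:E.
Proof.
pose V t := \int[P]_w (potential (state_at t w))%:E.
have mh (h : nat -> bool -> R) t : measurable_fun [set: borel H]
    ((fun w : H => (h (state_at t w) (action_at t w))%:E) : borel H -> \bar R).
  exact: (@measurable_coordinates _ _ (fun x a => (h x a)%:E)).
have Vdrift t : P [set w : H | state_at t w != 0%N] + V t.+1 <= V t.
  rewrite /V expectation_next//; last exact: potential_ge0.
  have -> : P [set w : H | state_at t w != 0%N] = \int[P]_w ((state_at t w != 0%N)%:R)%:E.
    rewrite -[LHS]mul1e -(setIT [set w | _]) -integral_indic//; last first.
      exact: (measurable_state_at dX t [set x | x != 0%N]).
    rewrite mul1e; apply: eq_integral => w _; rewrite indicE.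
    by congr ((nat_of_bool _)%:R%:E); apply/idP/idP => [/set_mem//|h]; exact: mem_set.
  rewrite -ge0_integralD//; last 3 first.
  - exact: (mh (fun x _ => (x != 0%N)%:R)).
  - by move=> w _; rewrite lee_fin mulr_ge0// ?potential_ge0//; have /andP[] := survival01 R (state_at t w) (action_at t w).
  - exact: (mh (fun x a => survival R x a * potential (target x a))%R).
  apply: ge0_le_integral => //.
  - move=> w _; rewrite -EFinD lee_fin addr_ge0// mulr_ge0// ?potential_ge0//.
    by have /andP[] := survival01 R (state_at t w) (action_at t w).
  - exact: (mh (fun x a => (x != 0%N)%:R + survival R x a * potential (target x a))%R).
  - exact: (mh (fun x a => potential x)%R).
  - by move=> w _; rewrite -EFinD lee_fin potential_drift.
have V0 : V 0%N = 4%:E.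
  have m0 : measurable (@state_at R M 0 @^-1` [set 1%N] : set (borel H)).
    exact: measurable_state_at.
  have P0 : P (~` (@state_at R M 0 @^-1` [set 1%N])) = 0.
    have [sP0 _ _] := sP; apply: (etrans (sP0 (~` [set 1%N]) _)).
      exact: discrete_measurable.
    by rewrite [LHS]diracE memNset//= => /(_ erefl).
  rewrite /V (ge0_negligible_integral _ _ _ _ P0)//; last 3 first.
  - exact: measurableC.
  - exact: (mh (fun x a => potential x)%R 0%N).
  - by move=> w _; rewrite lee_fin potential_ge0.
  rewrite setDE setTI setCK (@integral_cst_on _ _ _ P _ 4%:E)//; last first.
    by move=> w w0; rewrite w0 /potential/= expr1 -natrD.
  have : P (@state_at R M 0 @^-1` [set 1%N]) = 1.
    have [sP0 _ _] := sP; apply: (etrans (sP0 [set 1%N] _)).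
      exact: discrete_measurable.
    by rewrite [LHS]diracE mem_set.
  by move=> P1; rewrite [X in _ * X]P1 mule1.
apply: lime_le; first exact: is_cvg_nneseries.
apply: nearW => n; rewrite -V0.
suff : \sum_(0 <= t < n) P [set w : H | state_at t w != 0%N] + V n <= V 0%N.
  by apply: le_trans; rewrite leeDl// /V integral_ge0// => w _; rewrite lee_fin potential_ge0.
elim: n => [|n IH]; first by rewrite big_geq// add0e.
rewrite big_nat_recr//= -addeA; apply: le_trans IH; rewrite leeD2l//; exact: Vdrift.
Qed.

Lemma expected_hitting_time : \int[P]_w hitting_time (0%N : state M) 0 w < +oo.
Proof.
under eq_integral do rewrite hitting_time_tail.
rewrite expected_tail_time; apply: (@le_lt_trans _ _ 4%:E); last exact: ltry.
apply: le_trans survival_series_le; apply: lee_nneseries => // t _.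
apply: le_measure; rewrite ?inE//; first exact: measurable_lt_hitting_time.
  exact: (measurable_state_at dX t [set x | x != 0%N]).
by move=> w; rewrite /mkset lt_hitting_time => /asboolP/(_ t (leqnn t)) h; apply/eqP.
Qed.

End drift.

(** * Threshold strategies *)

Section threshold_strategies.
Variable R : realType.
Local Notation M := (model R).
Local Notation H := (trajectory M).

Let dX : forall U : set (state M), open U := @discrete_open nat.
Let dA : forall U : set (action M), open U := @discrete_open bool.

Lemma measurable_nat_fun (phi : borel nat -> borel bool) : measurable_fun setT phi.
Proof. by apply: discrete_measurable_fun => V; exact: discrete_open. Qed.

(** Iteration of [path_event_ge] along the path that is never absorbed. *)
Lemma survival_path_event (phi : borel nat -> borel bool)
    (mphi : measurable_fun [set: borel nat] phi) (P : probability (borel H) R)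
    (x : nat -> nat) t :
  is_strategic_measure (start R) (@deterministic_stationary R M phi mphi) P ->
  x 0%N = 1%N -> (forall s, x s.+1 = target (x s) (phi (x s))) ->
  ((\prod_(i < t) survival R (x i) (phi (x i)))%:E <= P (@path_event R M x t))%E.
Proof.
move=> sP x0 xS; elim: t => [|t IH].
  rewrite big_ord0; have [sP0 _ _] := sP.
  have -> : @path_event R M x 0 = [set w : H | [set (1%N : state M)] (state_at 0 w)].
    apply/seteqP; split => w; first by move=> /(_ 0%N isT) w0; exact: etrans w0 x0.
    by move=> w0 s; rewrite leqn0 => /eqP ->; rewrite x0.
  rewrite sP0; last exact: discrete_measurable.
  by rewrite [X in (_ <= X)%E]diracE mem_set.
apply: le_trans (path_event_ge dX dA x t sP).
rewrite big_ord_recr/= mulrC EFinM lee_pmul//.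
- by rewrite lee_fin; have /andP[] := survival01 R (x t) (phi (x t)).
- by rewrite lee_fin prodr_ge0// => i _; have /andP[] := survival01 R (x i) (phi (x i)).
- rewrite transitionE lee_fin xS !indicE mem_set// mulr1 lerDl.
  by rewrite mulr_ge0// subr_ge0; have /andP[] := survival01 R (x t) (phi (x t)).
Qed.

(** As the process starts in 1, this strategy climbs for [n] steps, up to the state [n.+1], and
    stays there until absorption. *)
Definition threshold (n : nat) : borel nat -> borel bool := fun x => (x < n.+1)%N.

Definition threshold_path (n t : nat) : nat := (minn t n).+1.

Lemma threshold_path_mass n k (P : probability (borel H) R) :
  is_strategic_measure (start R)
    (@deterministic_stationary R M (threshold n) (measurable_nat_fun (threshold n))) P ->
  ((2^-1 ^+ n * (1 - 2^-1 ^+ n.+1) ^+ k)%:E <=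
   P (@path_event R M (threshold_path n) (n + k)))%E.
Proof.
move=> sP; apply: le_trans (survival_path_event (n + k) sP _ _); last 2 first.
- by rewrite /threshold_path min0n.
- move=> s; rewrite /threshold_path /threshold /target.
  have [sn|ns] := ltnP s n.
    by rewrite ltnS sn; congr _.+1; apply/minn_idPl.
  by rewrite ltnn; congr _.+1; apply/minn_idPr/leqW.
rewrite lee_fin big_split_ord/=.
rewrite (eq_bigr (fun=> 2^-1)) => [|i _]; last first.
  rewrite /survival /threshold_path /threshold/=.
  have -> : minn i n = i by apply/minn_idPl/ltnW.
  by rewrite ltnS ltn_ord.
rewrite [X in _ <= _ * X](eq_bigr (fun=> 1 - 2^-1 ^+ n.+1)) => [|i _]; last first.
  rewrite /survival /threshold_path /threshold/=.
  have -> : minn (n + i) n = n by apply/minn_idPr/leq_addr.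
  by rewrite ltnn.
by rewrite !prodr_const !card_ord.
Qed.

(** From time [n] on the path sits in [n.+1], so the masses dominate a geometric series of total 2,
    and [k] terms that make up half of it suffice. *)
Lemma threshold_tail_mass n : exists k, forall P : probability (borel H) R,
  is_strategic_measure (start R)
    (@deterministic_stationary R M (threshold n) (measurable_nat_fun (threshold n))) P ->
  (1 <= \sum_(n <= t < n + k) P (@path_event R M (threshold_path n) t))%E.
Proof.
set u : R := 2^-1 ^+ n.+1; set q := 1 - u.
have u0 : 0 < u by rewrite exprn_gt0// invr_gt0.
have u1 : u <= 1 by apply: exprn_ile1; rewrite ?invr_ge0// invf_le1// ler1n.
have [k qk] : exists k, q ^+ k < 2^-1.
  have q1 : `|q| < 1 by rewrite ger0_norm /q ?subr_ge0// gtrBl.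
  have := cvg_expr q1 => /cvgrPdist_lt/(_ 2^-1); rewrite invr_gt0 ltr0n => /(_ isT)[k _].
  move=> /(_ k (leqnn k))/=; rewrite sub0r normrN => qk; exists k.
  exact: le_lt_trans (ler_norm _) qk.
exists k => P sP.
(* The geometric sum of [2^-n * q^j] over [j < k], because [2^-n = 2 * u] and [1 - q = u]. *)
apply: (@le_trans _ _ (2 * (1 - q ^+ k))%:E); first by rewrite lee_fin; lra.
elim: k {qk} => [|k IH]; first by rewrite expr0 subrr mulr0 addn0 big_geq.
rewrite addnS big_nat_recr ?leq_addr//=.
apply: le_trans (leeD IH (threshold_path_mass k sP)).
rewrite -EFinD lee_fin -/u -/q.
have -> : (2^-1 : R) ^+ n = 2 * u by rewrite /u exprS mulrA mulfV// mul1r.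
by rewrite exprS; move: (q ^+ k) => v; rewrite /q; lra.
Qed.

(** The strategy [threshold n] retains an expected survival time of at least 1 after time [n], so
    the suprema stay above 1. *)
Lemma not_uniformly_absorbing : ~ uniformly_absorbing (0%N : state M) (start R).
Proof.
move=> [_ lim0].
pose S n := ereal_sup [set (\int[P]_w tail_time (0%N : state M) n w)%E | P in
  [set P : probability (borel H) R | exists pi, is_strategic_measure (start R) pi P]].
have S1 n : (1 <= S n)%E.
  have [P sP] := deterministic_strategic_measure_exists R (measurable_nat_fun (threshold n)).
  have [k /(_ P sP) k1] := threshold_tail_mass n.
  apply: (@le_trans _ _ (\int[P]_w tail_time (0%N : state M) n w)%E); last first.
    by apply: ereal_sup_ubound; exists P => //; eexists; exact: sP.
  rewrite expected_tail_time; apply: le_trans k1 (le_trans _ (nneseries_lim_ge (n + k) _)) => //.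
  apply: lee_sum => t _; apply: le_measure; rewrite ?inE.
  - by apply: (measurable_nonanticipating dX dA); exact: nonanticipating_path_event.
  - exact: measurable_lt_hitting_time.
  move=> w pw; rewrite /mkset lt_hitting_time; apply/asboolP => i /andP[_ it].
  by rewrite (pw _ it).
have : (1 <= limn S)%E by apply: lime_ge; [exact: cvgP lim0|exact: nearW].
by rewrite (cvg_lim (@ereal_hausdorff R) lim0) lee_fin ler10.
Qed.

Lemma no_uniform_lyapunov : ~ exists mu : state M -> R, is_uniform_lyapunov (0%N : state M) mu.
Proof.
move=> [mu [mu1 mu_drift _ mu_lim]].
(* Only the term [y = n.+1] of the drift for staying is kept: with [u = 2^-(n+1)] and [m = mu n.+1],
   the inequality [1 + (1 - u) * m <= m] says [u * m >= 1]. *)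
have mu_ge n : 2 ^+ n.+1 <= mu n.+1.
  have mu_ge0 x : (0 <= (mu x)%:E)%E by rewrite lee_fin (le_trans ler01).
  have := mu_drift n.+1 false.
  have stay : ((1 - 2^-1 ^+ n.+1) * mu n.+1)%:E = (transition M (n.+1, false) [set n.+1] * (mu n.+1)%:E)%E.
    rewrite transitionE !indicE mem_set// memNset//.
    by rewrite mulr1 mulr0 addr0 -EFinM.
  have : (((1 - 2^-1 ^+ n.+1) * mu n.+1)%:E <= \esum_(y in ~` [set (0%N : state M)])
      (transition M (n.+1, false) [set y] * (mu y)%:E))%E.
    rewrite stay; apply: esum_ge; exists [set (n.+1 : state M)]; last by rewrite fsbig_set1.
    by split; [exact: finite_set1|move=> y /= ->].
  set S := esum _ _; move: S => S h1 h2.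
  have := le_trans (leeD2l 1%E h1) h2; rewrite -EFinD lee_fin.
  have : (2^-1 : R) ^+ n.+1 * 2 ^+ n.+1 = 1 by rewrite -exprMn mulVf// expr1n.
  have : 0 < (2 : R) ^+ n.+1 by rewrite exprn_gt0.
  set u := 2^-1 ^+ _; set v := 2 ^+ _ => v0 uv h.
  have : 1 <= u * mu n.+1 by lra.
  by rewrite -[in X in X -> _]uv (mulrC u v); nra.
pose phi : borel nat -> borel bool := fun=> true.
have [P sP] := deterministic_strategic_measure_exists R (measurable_nat_fun phi).
have lim0 := mu_lim 1%N phi (measurable_nat_fun phi) P sP.
pose x (t : nat) := t.+1.
have Px t : ((2^-1 ^+ t)%:E <= P (@path_event R M x t))%E.
  apply: le_trans (survival_path_event t sP _ _) => //.
  rewrite (eq_bigr (fun=> 2^-1)) => [|i _]; last by rewrite /survival.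
  by rewrite prodr_const card_ord.
set f := (X in X @ \oo --> _) in lim0.
(* Climbing [t] times succeeds with probability at least [2^-t] and leads to [t.+1], where [mu] is
   at least [2^(t+1)]; the product is 2. *)
have f2 t : (2%:E <= f t)%E.
  have mE : measurable (@path_event R M x t : set (borel H)).
    by apply: (measurable_nonanticipating dX dA); exact: nonanticipating_path_event.
  have pE w : @path_event R M x t w ->
      ((mu (state_at t w) * (t%:R%:E < hitting_time (0%N : state M) 1 w)%E%:R)%R%:E = (mu t.+1)%:E).
    move=> pw; rewrite lt_hitting_time; case: asboolP => [_|[] i /andP[_ it]].
      by rewrite mulr1 (pw t).
    by rewrite (pw i it).
  apply: (@le_trans _ _ (\int[P]_(w in @path_event R M x t) (mu t.+1)%:E)%E).
    rewrite integral_cst//; apply: (@le_trans _ _ ((2 ^+ t.+1)%:E * (2^-1 ^+ t)%:E)%E).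
      by rewrite -EFinM lee_fin exprS -mulrA -exprMn mulfV// expr1n mulr1.
    by rewrite lee_pmul// ?lee_fin ?exprn_ge0 ?invr_ge0// mu_ge.
  rewrite (eq_integral (fun w : borel H => (mu (state_at t w) *
    (t%:R%:E < hitting_time (0%N : state M) 1 w)%E%:R)%:E)); last by move=> w /set_mem/pE ->.
  apply: ge0_subset_integral => //.
  - move=> _ B _; rewrite setTI.
    apply: (measurable_nonanticipating dX dA (t := t)) => w w' /eq_history_at[hs _].
    rewrite /preimage/mkset hs// (_ : (t%:R%:E < hitting_time _ 1 w')%E =
      (t%:R%:E < hitting_time (0%N : state M) 1 w)%E)//.
    rewrite !lt_hitting_time; apply/asboolP/asboolP => h i it; have := h i it; rewrite hs//;
      by case/andP: it.
  - by move=> w _; rewrite lee_fin mulr_ge0// (le_trans ler01).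
have : (2%:E <= limn f)%E by apply: lime_ge; [exact: cvgP lim0|exact: nearW].
by rewrite (cvg_lim (@ereal_hausdorff R) lim0) lee_fin lern0.
Qed.

End threshold_strategies.

(** * Occupation measures *)

Section occupation_measures.
Local Open Scope ereal_scope.
Variables (R : realType) (M : mdp R).
Hypotheses (dX : forall U : set (state M), open U) (dA : forall U : set (action M), open U).
Variables (z : state M) (hz : (~` [set z] : set (state M)) !=set0).
Local Notation H := (trajectory M).
Local Notation Y := (punctured hz * action M)%type.

Lemma discrete_punctured (V : set (punctured hz)) : open V.
Proof.
rewrite (_ : V = set_val @^-1` (set_val @` V)).
  by apply: open_comp => // x _; exact: initial_continuous.
apply/seteqP; split => x; first by exists x.
by move=> [y Vy /val_inj <-].
Qed.

Lemma discrete_punctured_product (U : set Y) : open U.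
Proof. by apply: discrete_prod => // V; exact: discrete_punctured. Qed.

(** The laws of state and action at time [t], restricted to the states other than [z], are summed
    over [t]; the total mass is the given series. *)
Lemma occupation_measure_exists (P : probability (borel H) R) :
  \sum_(0 <= t <oo) P [set w : H | state_at t w <> z] < +oo ->
  exists eta : weak_finite_measures R Y, is_occupation_measure (hz := hz) P eta.
Proof.
move=> Pfin.
(* A filler for the state [z], used only on the event that the restriction of [P] in [nu]
   removes. *)
pose x0 : set_type (~` [set z]) := (point : punctured hz).
pose j t (w : borel H) : borel Y :=
  ((insubd x0 (state_at t w) : set_type (~` [set z])) : punctured hz, action_at t w).
have mQ t (Q : set (state M * action M)) :
    measurable ([set w : H | Q (state_at t w, action_at t w)] : set (borel H)).
  apply: (measurable_nonanticipating dX dA (t := t.+1)) => w w' /eq_history_at[hs ha].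
  by rewrite /mkset hs// ha.
have mj t : measurable_fun setT (j t).
  move=> _ B _; rewrite setTI.
  exact: (mQ t (fun xa => B ((insubd x0 xa.1 : set_type (~` [set z])) : punctured hz, xa.2))).
have mZ t : measurable ([set w : H | state_at t w <> z] : set (borel H)).
  exact: (mQ t (fun xa => xa.1 <> z)).
pose nu t : {measure set (borel Y) -> \bar R} :=
  pushforward (mrestr P (mZ t)) (j t).
pose mu : {measure set (borel Y) -> \bar R} := mseries (nu mj) 0.
have muE B : mu B = \sum_(0 <= t <oo) P (j t @^-1` B `&` [set w : H | state_at t w <> z]) by [].
have mu_fin : fin_num_fun mu.
  apply: lty_fin_num_fun; rewrite muE; apply: le_lt_trans Pfin.
  by apply: lee_nneseries => // t _; rewrite preimage_setT setTI.
pose eta : finite_measures R Y := HB.pack (mu : set (borel Y) -> \bar R) (Measure.on mu)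
  (Measure_isFinite.Build _ _ _ mu mu_fin).
exists (eta : weak_finite_measures R Y) => GX GA _ _.
rewrite [LHS]muE; apply: eq_eseriesr => t _; congr (P _).
apply/seteqP; split => w.
  move=> [[/= GXw GAw] wz]; split => //; exists (j t w).1 => //.
  by rewrite /j/= set_valE insubdK//; apply: mem_set.
move=> [[x GXx xw] GAw]; split.
  split => //=; rewrite (_ : insubd _ _ = x)//; apply: val_inj.
  by rewrite -xw insubdK// -set_valE; exact: valP.
by rewrite /mkset -xw; have /set_mem := valP x.
Qed.

End occupation_measures.

(** * Escape of occupation mass to infinity *)

Section escaping_occupation_measures.
Variable R : realType.
Local Notation M := (model R).
Local Notation H := (trajectory M).
Variable hz : (~` [set (0%N : state M)] : set (state M)) !=set0.
Local Notation Y := (punctured hz * action M)%type.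

Let dX : forall U : set (state M), open U := @discrete_open nat.
Let dA : forall U : set (action M), open U := @discrete_open bool.

(** The space is discrete, so the indicators of these tail sets are admissible test functions for
    the weak topology. *)
Let above (N : nat) : set Y := [set xa | (N <= (set_val xa.1 : nat))%N].

Let above_indic (N : nat) : Y -> R := \1_(above N).

Let above_continuous_bounded N : continuous (above_indic N) /\ bounded_fun (above_indic N).
Proof.
split.
  by apply: discrete_continuous => V; exact: discrete_punctured_product.
exists 1; split; first exact: num_real.
by move=> x x1 y _; rewrite /= /above_indic indicE ger0_norm// (le_trans _ (ltW x1))// lern1 leq_b1.
Qed.

Let above_test N : bounded_continuous R Y := exist _ _ (above_continuous_bounded N).

Let measurable_Y (B : set (borel Y)) : measurable B.
Proof. by apply: discrete_measurable => V; exact: discrete_punctured_product. Qed.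

Let integrals_above (eta : {finite_measure set (borel Y) -> \bar R}) N :
  integrals eta (above_test N) = fine (eta (above N)).
Proof. by rewrite /integrals/= /Rintegral integral_indic ?setIT. Qed.

(** From time [n] on the threshold path sits in [n.+1], above [N], and [threshold_tail_mass] counts
    its visits there. *)
Lemma occupation_mass_escapes (P : probability (borel H) R) n N
    (eta : weak_finite_measures R Y) : (N <= n)%N ->
  is_strategic_measure (start R)
    (@deterministic_stationary R M (threshold n) (measurable_nat_fun (threshold n))) P ->
  is_occupation_measure (hz := hz) P eta ->
  1 <= integrals (eta : {finite_measure set (borel Y) -> \bar R}) (above_test N).
Proof.
move=> Nn sP etaP; rewrite integrals_above -lee_fin fineK; last exact: fin_num_measure.
rewrite (_ : above N = [set x : punctured hz | (N <= (set_val x : nat))%N] `*` setT); last first.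
  by apply/seteqP; split => -[x a] //= -[].
rewrite etaP; last 2 first.
- by apply: discrete_measurable => V; exact: discrete_punctured.
- exact: discrete_measurable.
have [k /(_ P sP) k1] := threshold_tail_mass R n.
apply: (le_trans k1).
apply: (@le_trans _ _ (\sum_(n <= t < n + k) P [set w : H |
  (@set_val _ (~` [set (0%N : state M)]) @` [set x : punctured hz | (N <= (set_val x : nat))%N])
    (state_at t w) /\ setT (action_at t w)])%E).
  rewrite big_nat [leRHS]big_nat; apply: lee_sum => t /andP[nt _].
  apply: le_measure; rewrite ?inE.
  - by apply: (measurable_nonanticipating dX dA); exact: nonanticipating_path_event.
  - apply: (measurable_nonanticipating dX dA (t := t)) => w w' /eq_history_at[hs _].
    by rewrite /mkset hs.
  move=> w pw; split => //; rewrite (pw t (leqnn t)) /threshold_path.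
  have -> : minn t n = n by apply/minn_idPr.
  have n0 : (~` [set (0%N : state M)]) n.+1 by [].
  exists (exist _ (n.+1 : state M) (mem_set n0)) => //=.
  exact: leqW.
apply: le_trans (nneseries_lim_ge (n + k) _) => //.
by rewrite [leRHS](@big_cat_nat _ _ _ n)//= ?leq_addr// leeDr// sume_ge0.
Qed.

(** By continuity from above, the finite measure [eta] gives mass less than 1 to some tail set. This
    defines a weak neighbourhood of [eta] that the sequence eventually avoids. *)
Lemma escaping_not_cluster (eta : weak_finite_measures R Y)
    (etas : nat -> weak_finite_measures R Y) :
  (forall n N, (N <= n)%N -> 1 <= integrals
     (etas n : {finite_measure set (borel Y) -> \bar R}) (above_test N)) ->
  ~ cluster (etas @ \oo) eta.
Proof.
move=> esc cl.
pose mu := (eta : {finite_measure set (borel Y) -> \bar R}).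
have [N muN] : exists N, fine (mu (above N)) < 1.
  have cv : mu \o above @ \oo --> mu (\bigcap_n above n).
    apply: nonincreasing_cvg_mu => //.
    - by rewrite -ge0_fin_numE//; exact: fin_num_measure.
    - move=> i j ij; apply/subsetPset => xa; exact: leq_trans.
  rewrite (_ : \bigcap_n above n = set0) in cv; last first.
    apply/seteqP; split => // xa /(_ (set_val xa.1 : nat).+1 I).
    by rewrite /above/= ltnn.
  rewrite measure0 in cv.
  move/fine_cvg/cvgrPdist_lt/(_ 1 ltr01) : cv => [N _ /(_ N (leqnn N))] /=.
  rewrite sub0r normrN => h; exists N; exact: le_lt_trans (ler_norm _) h.
pose U := [set nu : weak_finite_measures R Y |
  integrals (nu : {finite_measure set (borel Y) -> \bar R}) (above_test N) < 1].
have Ueta : nbhs eta U.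
  have oB : open [set m : prod_topology (fun _ : bounded_continuous R Y => R) |
      m (above_test N) < 1].
    apply: (@open_comp _ _ (fun m : prod_topology (fun _ : bounded_continuous R Y => R) =>
      m (above_test N)) [set r | r < 1]); last exact: open_lt.
    by move=> m _; exact: (@proj_continuous {classic bounded_continuous R Y} (fun=> R)).
  exists U; split => //=; first by exists [set m | m (above_test N) < 1].
  by rewrite /U/= integrals_above.
have tail : (etas @ \oo) (~` U).
  by exists N => // n Nn /=; rewrite /U/= ltNge esc.
by have [nu []] := cl _ _ tail Ueta.
Qed.

End escaping_occupation_measures.

(** * The six assertions for the model *)

Theorem theorem1 (R : realType) :
  exists (M : mdp R) (P0 : probability (borel (state M)) R) (z : state M)
         (hz : (~` [set z] : set (state M)) !=set0),
    [/\ countable [set: state M],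
        (forall U : set (state M), open U) &
        isolated_absorbing_state z] /\
    (* (a) *) (semicontinuous M /\ compact (strategic_measures P0)) /\
    (* (b) *) absorbing z P0 /\
    (* (c) *) ~ uniformly_absorbing z P0 /\
    (* (d) *) ~ compact (occupation_measures hz P0) /\
    (* (e) *) (exists O : strategic_measures P0 -> occupation_measures hz P0,
                 (forall P, is_occupation_measure (val P) (val (O P))) /\
                 ~ continuous O) /\
    (* (f) *) ~ (exists mu : state M -> R, is_uniform_lyapunov z mu).
Proof.
pose M := model R; pose z : state M := 0%N.
have dX : forall U : set (state M), open U := @discrete_open nat.
have dA : forall U : set (action M), open U := @discrete_open bool.
have hz : (~` [set z] : set (state M)) !=set0 by exists (1%N : nat).
have iso : isolated_absorbing_state z.
  split; last first.
    move=> a; rewrite transitionE /survival/= mul0r add0r subr0 mul1r.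
    by rewrite indicE mem_set.
  split; first exact: mem_set.
  by exists [set z]; [exact: discrete_nbhs|rewrite setIT].
have occ (P : strategic_measures (start R)) :
    {eta : occupation_measures hz (start R) | is_occupation_measure (hz := hz) (val P) (val eta)}.
  apply: cid; have /set_mem[pi sP] := valP P.
  have [|eta etaP] := @occupation_measure_exists R M dX dA z hz (val P).
    apply: le_lt_trans (ltry 4); apply: le_trans (survival_series_le sP).
    apply: lee_nneseries => // t _; apply: le_measure; rewrite ?inE.
    - exact: (measurable_state_at dX t [set x | x <> 0%N]).
    - exact: (measurable_state_at dX t [set x | x != 0%N]).
    - by move=> w /eqP.
  have Deta : eta \in occupation_measures hz (start R).
    by apply: mem_set; exists (val P) => //; exists pi.
  by exists (exist _ eta Deta).
have thr n : {P : strategic_measures (start R) | is_strategic_measure (start R)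
    (@deterministic_stationary R M (threshold n) (measurable_nat_fun (threshold n)))
    (val P : probability (borel (trajectory M)) R)}.
  apply: cid.
  have [P sP] := deterministic_strategic_measure_exists R (measurable_nat_fun (threshold n)).
  have SP : (P : weak_probabilities R (trajectory M)) \in strategic_measures (start R).
    by apply: mem_set; eexists; exact: sP.
  by exists (exist _ (P : weak_probabilities R (trajectory M)) SP).
pose O P := sval (occ P).
pose etas n := val (O (sval (thr n))).
have not_cluster eta : ~ cluster (etas @ \oo) eta.
  apply: escaping_not_cluster => n N Nn.
  exact: (occupation_mass_escapes Nn (svalP (thr n)) (svalP (occ (sval (thr n))))).
have cS := @strategic_measures_compact R.
exists M, (start R), z, hz; split; first by split => //; exact: countableP.
split; first split => //.
  (* Condition (S) holds: the two actions form a finite discrete space, on which every function is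
     continuous. *)
  left; split; first exact: bool_compact.
  by move=> x u _ _; exact: discrete_continuous.
split; first by split => // pi P sP; exact: expected_hitting_time sP.
split; first exact: not_uniformly_absorbing.
split.
  move=> cD; have [|eta [_ cl]] := cD (etas @ \oo) _; last exact: (not_cluster eta).
  by exists 0%N => // n _; exact: set_mem (valP _).
split; last exact: no_uniform_lyapunov.
exists O; split; first by move=> P; exact: (svalP (occ P)).
(* If [O] were continuous, a cluster point of the threshold measures, which exists by compactness,
   would be mapped to a cluster point of their occupation measures. *)
move=> cO.
pose Ps n : weak_probabilities R (trajectory M) := val (sval (thr n)).
have [|P [SP cl]] := cS (Ps @ \oo) _.
  by exists 0%N => // n _; exact: set_mem (valP _).
pose P' : strategic_measures (start R) := exist _ P (mem_set SP).
apply: (not_cluster (val (O P'))) => V U tV OU.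
have : nbhs P' [set Q | U (val (O Q))].
  have := @initial_continuous _ _ (set_val : occupation_measures hz (start R) -> _) (O P') U OU.
  by move=> /cO.
move=> [B [[W oW <-] WP BU]].
have nW : nbhs P W by apply: open_nbhs_nbhs.
(* The set consists of values of [Ps], so that clustering yields an index [n] and not merely a
   measure. *)
have tW : (Ps @ \oo) [set Ps n | n in etas @^-1` V].
  by case: tV => N _ tV; exists N => // n /tV Vn; exists n.
have [_ [[n Vn <-] Wn]] := cl _ _ tW nW.
by exists (etas n); split => //; exact: BU.
Qed.
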